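(* Let $m\ge2$ and $n\ge1$ be integers and let $0<s<1$. Suppose that $1<p_1,\dots,p_m<\infty$ and $1/m<p<\infty$ satisfy $1/p=1/p_1+\cdots+1/p_m$ and $$(1/p_1,\dots,1/p_m)\in\bigcup_{J\subseteq J_m:\ |J|\ge2}\mathcal{O}^m_J(s).$$ Then there exists $\Omega\in L^{\frac1{1-s}}(\mathbb{S}^{mn-1})$ with $\int_{\mathbb{S}^{mn-1}}\Omega\,d\sigma=0$ such that the estimate $$\big\Vert\mathcal{L}_\Omega\big\Vert_{L^{p_1}\times\cdots\times L^{p_m}\to L^p}\lesssim\Vert\Omega\Vert_{L^{\frac1{1-s}}(\mathbb{S}^{mn-1})}$$ does not hold, i.e. there is no finite constant $C$ such that $\Vert\mathcal{L}_\Omega(f_1,\dots,f_m)\Vert_{L^p(\mathbb{R}^n)}\le C\Vert\Omega\Vert_{L^{\frac1{1-s}}(\mathbb{S}^{mn-1})}\prod_{j=1}^m\Vert f_j\Vert_{L^{p_j}(\mathbb{R}^n)}$ for all Schwartz functions $f_1,\dots,f_m$ on $\mathbb{R}^n$. In particular, for $1\le q<\frac{2(m-1)}{m}$, there exists a function $\Omega\in L^q(\mathbb{S}^{mn-1})$ with $\int_{\mathbb{S}^{mn-1}}\Omega\,d\sigma=0$ such that $\mathcal{L}_\Omega$ is unbounded from $L^2(\mathbb{R}^n)\times\cdots\times L^2(\mathbb{R}^n)$ to $L^{2/m}(\mathbb{R}^n)$.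
   Context: For an integrable function $\Omega$ on the unit sphere $\mathbb{S}^{mn-1}$ of $(\mathbb{R}^n)^m=\mathbb{R}^{mn}$ (with surface measure $\sigma$) having mean value zero, set $K(\vec y)=\Omega(\vec y/|\vec y|)/|\vec y|^{mn}$ for $\vec y=(y_1,\dots,y_m)\in(\mathbb{R}^n)^m\setminus\{0\}$ and $$\mathcal{L}_\Omega(f_1,\dots,f_m)(x)=\mathrm{p.v.}\int_{(\mathbb{R}^n)^m}K(\vec y)\prod_{j=1}^m f_j(x-y_j)\,d\vec y,\qquad x\in\mathbb{R}^n,$$ for Schwartz functions $f_1,\dots,f_m$ on $\mathbb{R}^n$, where p.v. means the limit as $\varepsilon\to0^+$ of the integrals over $|\vec y|>\varepsilon$. Boundedness from $L^{p_1}\times\cdots\times L^{p_m}$ to $L^p$ refers to the estimate $\Vert\mathcal{L}_\Omega(f_1,\dots,f_m)\Vert_{L^p}\le C\prod_j\Vert f_j\Vert_{L^{p_j}}$ for all Schwartz functions with a finite constant $C$ independent of the $f_j$. Let $J_m=\{1,\dots,m\}$. For $0<s<1$ and $J\subseteq J_m$ let $$\mathcal{O}^m_J(s)=\Big\{(t_1,\dots,t_m)\in(0,1)^m:\ \sum_{j\in J}(s-t_j)<-(1-s)\Big\}.$$ *)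

(* Defs.v *)
From HB Require Import structures.
From mathcomp Require Import all_boot all_order all_algebra.
From mathcomp Require Import all_classical all_reals all_analysis.
From mathcomp Require Import measurable_realfun complex.
Set Implicit Arguments.
Unset Strict Implicit.
Unset Printing Implicit Defensive.
Import Order.TTheory GRing.Theory Num.Theory.
Import numFieldNormedType.Exports.
Local Open Scope classical_set_scope.
Local Open Scope ring_scope.

Section cons_measure.
Local Open Scope ereal_scope.
Context d (T : measurableType d) (R : realType) (k : nat).
Variables (mu : {sigma_finite_measure set T -> \bar R})
  (nu : {sigma_finite_measure set (k.-tuple T) -> \bar R}).

Definition consx (x : T * k.-tuple T) : k.+1.-tuple T := [tuple of x.1 :: x.2].

Lemma measurable_consx : measurable_fun setT consx.
Proof.
by apply: (@measurable_cons _ _ (T * k.-tuple T)%type T fst k snd);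
  [exact: measurable_fst|exact: measurable_snd].
Qed.

Definition cons_measure : set (k.+1.-tuple T) -> \bar R :=
  pushforward (mu \x nu) consx.

Let cons_measure0 : cons_measure set0 = 0.
Proof. by rewrite /cons_measure /pushforward preimage_set0 measure0. Qed.

Let cons_measure_ge0 A : 0 <= cons_measure A.
Proof. by rewrite /cons_measure /pushforward; exact: measure_ge0. Qed.

Let cons_measure_sigma_additive : semi_sigma_additive cons_measure.
Proof.
move=> F mF tF mUF; rewrite /cons_measure /pushforward preimage_bigcup.
apply: measure_semi_sigma_additive.
- by move=> n; rewrite -[X in measurable X]setTI; exact: measurable_consx.
- apply/trivIsetP => /= i j _ _ ij; rewrite -preimage_setI.
  by move/trivIsetP : tF => /(_ _ _ _ _ ij) ->//; rewrite preimage_set0.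
- by rewrite -preimage_bigcup -[X in measurable X]setTI; exact: measurable_consx.
Qed.

HB.instance Definition _ := isMeasure.Build _ _ _ cons_measure
  cons_measure0 cons_measure_ge0 cons_measure_sigma_additive.

Let uncons (t : k.+1.-tuple T) : T * k.-tuple T :=
  (thead t, [tuple of behead t]).

Let measurable_uncons : measurable_fun setT uncons.
Proof.
apply/measurable_fun_pair; first exact: measurable_tnth.
exact: measurable_behead.
Qed.

Let cons_measure_sigma_finite : sigma_finite setT cons_measure.
Proof.
have [F FT Foo] : sigma_finite setT (mu \x nu).
  have /sigma_finiteP[F [TF ndF Foo]] := sigma_finiteT mu.
  have /sigma_finiteP[G [TG ndG Goo]] := sigma_finiteT nu.
  exists (fun n => F n `*` G n).
    rewrite -setXTT TF TG predeqE => -[x y]; split.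
      move=> [/= [n _ Fnx] [l _ Gky]]; exists (maxn n l) => //; split.
      - by move: x Fnx; exact/subsetPset/ndF/leq_maxl.
      - by move: y Gky; exact/subsetPset/ndG/leq_maxr.
    by move=> [n _ []/= ? ?]; split; exists n.
  move=> l; have [? ?] := Foo l; have [? ?] := Goo l.
  split; first exact: measurableX.
  by rewrite product_measure1E// lte_mul_pinfty// ge0_fin_numE.
exists (fun i => uncons @^-1` F i).
  by rewrite -preimage_bigcup -FT preimage_setT.
move=> i; have [mF Fi] := Foo i; split.
  by rewrite -[X in measurable X]setTI; exact: measurable_uncons.
rewrite /cons_measure /pushforward -comp_preimage.
rewrite (_ : uncons \o consx = id)//.
apply/funext => -[x t]; rewrite /uncons /=; congr (_, _).
exact/val_inj.
Qed.

HB.instance Definition _ := Measure_isSigmaFinite.Build _ _ _ cons_measure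
  cons_measure_sigma_finite.

End cons_measure.

Fixpoint tuple_measure d (T : measurableType d) (R : realType)
    (mu : {sigma_finite_measure set T -> \bar R}) (k : nat) :
    {sigma_finite_measure set (k.-tuple T) -> \bar R} :=
  if k is k'.+1 then cons_measure mu (tuple_measure mu k')
  else dirac ([tuple] : 0.-tuple T).

Lemma tuple_measure_box d (T : measurableType d) (R : realType)
    (mu : {sigma_finite_measure set T -> \bar R}) (k : nat) (A : 'I_k -> set T) :
  (forall i, measurable (A i)) ->
  tuple_measure mu k [set t | forall i, A i (tnth t i)] =
  (\prod_(i < k) mu (A i))%E.
Proof.
elim: k A => [|k IH] A mA.
  rewrite big_ord0 /= diracE mem_set//= => -[] //.
rewrite big_ord_recl -(IH (fun i => A (lift ord0 i)))// -product_measure1E//.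
- rewrite /= /cons_measure /pushforward; congr (_ _); apply/seteqP.
  split=> -[x t] /=.
    move=> H; split => [|i]; first exact: (H ord0).
    by have := H (lift ord0 i); rewrite /consx tnthS.
  move=> [Ax At] i; case: (unliftP ord0 i) => [j ->|->//].
  by rewrite /consx tnthS.
- rewrite (_ : mkset _ =
     \bigcap_(i in setT) ((@tnth _ _)^~ i @^-1` A (lift ord0 i))); last first.
    by apply/seteqP; split => t /= H i; [move=> _|]; exact: H.
  apply: fin_bigcap_measurable => // i _.
  by rewrite -[X in measurable X]setTI; exact: measurable_tnth.
Qed.

(* R^n is 'rV[R]_n and (R^n)^m is 'M[R]_(m, n), the j-th vector of y being
   row j y.  Both carry the product Borel sigma-algebra, i.e. the one generated
   by the coordinates. *)
Section mx_measurable.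
Context (R : realType) (m n : nat).

Let coors (k : 'I_(m * n)) (y : 'M[R]_(m, n)) : R := mxvec y ord0 k.

Let mx_set0 : g_sigma_preimage coors set0.
Proof. exact: sigma_algebra0. Qed.

Let mx_setC A : g_sigma_preimage coors A -> g_sigma_preimage coors (~` A).
Proof. exact: sigma_algebraC. Qed.

Let mx_bigcup (F : (set 'M[R]_(m, n))^nat) :
  (forall i, g_sigma_preimage coors (F i)) ->
  g_sigma_preimage coors (\bigcup_i (F i)).
Proof. exact: sigma_algebra_bigcup. Qed.

HB.instance Definition _ := @isMeasurable.Build default_measure_display
  'M[R]_(m, n) (g_sigma_preimage coors) mx_set0 mx_setC mx_bigcup.

Lemma measurable_coord (i : 'I_m) (j : 'I_n) :
  measurable_fun setT (fun y : 'M[R]_(m, n) => y i j).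
Proof.
move=> _ Y mY; rewrite setTI; apply: sub_sigma_algebra => /=.
rewrite -bigcup_seq/=; exists (mxvec_index i j).
  by rewrite /= mem_index_enum.
exists Y => //; rewrite setTI; apply/seteqP; split=> y;
  by rewrite /preimage /coors/= mxvecE.
Qed.

Lemma measurable_fun_mxP d (T : measurableType d) (f : T -> 'M[R]_(m, n)) :
  (forall i j, measurable_fun setT (fun x => f x i j)) -> measurable_fun setT f.
Proof.
move=> mf.
have /= coorsf : forall A, (\big[setU/set0]_(k < m * n)
    preimage_set_system setT (coors k) measurable) A ->
    measurable (f @^-1` A).
  move=> A; rewrite -bigcup_seq => -[k _ [B mB <-]].
  rewrite setTI; case/mxvec_indexP: k => i j.
  rewrite -comp_preimage -[X in measurable X]setTI.
  rewrite (_ : _ \o f = fun x => f x i j); first exact: mf.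
  by apply/funext => x; rewrite /coors/= mxvecE.
suff H : measurable `<=` [set A : set 'M[R]_(m, n) | measurable (f @^-1` A)].
  by move=> _ A mA; rewrite setTI; exact: H.
apply: smallest_sub; last by move=> A; exact: coorsf.
split=> [|A mA|F mF] /=.
- by rewrite preimage_set0; exact: measurable0.
- by rewrite setTD -preimage_setC; exact: measurableC.
- by rewrite preimage_bigcup; exact: bigcupT_measurable.
Qed.

Definition enorm (y : 'M[R]_(m, n)) : R :=
  Num.sqrt (\sum_i \sum_j y i j ^+ 2).

Lemma measurable_enorm : measurable_fun setT enorm.
Proof.
apply: (@measurableT_comp _ _ _ _ _ _ (@Num.sqrt R)).
  by apply: continuous_measurable_fun; exact: sqrt_continuous.
apply: measurable_sum => i; apply: measurable_sum => j.
by apply: measurable_funX; exact: measurable_coord.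
Qed.

End mx_measurable.

Section lebesgue_mx.
Local Open Scope ereal_scope.
Context (R : realType) (m n : nat).

Definition mx_of_tuple (t : (m * n).-tuple R) : 'M[R]_(m, n) :=
  \matrix_(i, j) tnth t (mxvec_index i j).

Lemma measurable_mx_of_tuple :
  measurable_fun [set: (m * n).-tuple (measurableTypeR R)] mx_of_tuple.
Proof.
apply: measurable_fun_mxP => i j; rewrite /mx_of_tuple.
rewrite [X in measurable_fun _ X](_ : _ =
  fun x : (m * n).-tuple (measurableTypeR R) => tnth x (mxvec_index i j)).
  exact: measurable_tnth.
by apply/funext => x; rewrite mxE.
Qed.

Definition lebesgue_mx : set 'M[R]_(m, n) -> \bar R :=
  pushforward (tuple_measure (@lebesgue_measure R) (m * n)) mx_of_tuple.

Let lebesgue_mx0 : lebesgue_mx set0 = 0.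
Proof. by rewrite /lebesgue_mx /pushforward preimage_set0 measure0. Qed.

Let lebesgue_mx_ge0 A : 0 <= lebesgue_mx A.
Proof. by rewrite /lebesgue_mx /pushforward; exact: measure_ge0. Qed.

Let lebesgue_mx_sigma_additive : semi_sigma_additive lebesgue_mx.
Proof.
move=> F mF tF mUF; rewrite /lebesgue_mx /pushforward preimage_bigcup.
apply: measure_semi_sigma_additive.
- by move=> k; rewrite -[X in measurable X]setTI; exact: measurable_mx_of_tuple.
- apply/trivIsetP => /= i j _ _ ij; rewrite -preimage_setI.
  by move/trivIsetP : tF => /(_ _ _ _ _ ij) ->//; rewrite preimage_set0.
- rewrite -preimage_bigcup -[X in measurable X]setTI.
  exact: measurable_mx_of_tuple.
Qed.

HB.instance Definition _ := isMeasure.Build _ _ _ lebesgue_mx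
  lebesgue_mx0 lebesgue_mx_ge0 lebesgue_mx_sigma_additive.

Lemma lebesgue_mx_box (A : 'I_m -> 'I_n -> set R) :
  (forall i j, measurable (A i j)) ->
  lebesgue_mx [set y | forall i j, A i j (y i j)] =
  \prod_i \prod_j lebesgue_measure (A i j).
Proof.
move=> mA.
have [g gK Kg] := curry_mxvec_bij m n.
pose B k := A (g k).1 (g k).2.
rewrite pair_bigA /= (reindex g) /=; last first.
  by exists (uncurry (@mxvec_index m n)) => k _; [exact: Kg|exact: gK].
rewrite -[RHS](@tuple_measure_box _ _ _ (@lebesgue_measure R) _ B); last first.
  by move=> k; exact: mA.
rewrite /lebesgue_mx /pushforward; congr (_ _).
apply/seteqP; split=> t /= At.
  move=> k; rewrite /B; have := At (g k).1 (g k).2; rewrite mxE.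
  by have := Kg k; case: (g k) => i j /= ->.
move=> i j; rewrite mxE; have := At (mxvec_index i j).
by rewrite /B (gK (i, j)).
Qed.

End lebesgue_mx.

Section surface_measure.
Local Open Scope ereal_scope.
Context (R : realType) (m n : nat).

Definition direction (y : 'M[R]_(m, n)) : 'M[R]_(m, n) := (enorm y)^-1 *: y.

Lemma measurable_direction : measurable_fun setT direction.
Proof.
apply: measurable_fun_mxP => i j.
rewrite [X in measurable_fun _ X](_ : _ =
  (fun y => enorm y `^ (-1) * y i j)%R); last first.
  by apply/funext => y; rewrite mxE powR_inv1// sqrtr_ge0.
apply: measurable_funM; last exact: measurable_coord.
apply: (@measurableT_comp _ _ _ _ _ _ (fun a : R => a `^ (-1))%R).
  exact: measurable_powR.
exact: measurable_enorm.
Qed.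

Definition unit_sphere : set 'M[R]_(m, n) := [set y | enorm y = 1%R].

Definition cone (A : set 'M[R]_(m, n)) : set 'M[R]_(m, n) :=
  [set y | (0 < enorm y <= 1)%R /\ A (direction y)].

(* Normalized by polar coordinates: sigma A = d * |{r w : 0 < r <= 1, w in A}|
   in dimension d = m * n.  It is a measure on the ambient space, which gives no
   mass to the complement of the unit sphere. *)
Definition surface_measure (A : set 'M[R]_(m, n)) : \bar R :=
  (m * n)%:R%:E * @lebesgue_mx R m n (cone A).

Lemma measurable_cone A : measurable A -> measurable (cone A).
Proof.
move=> mA; rewrite (_ : cone A = (@enorm R m n @^-1` `]0%R, 1%R]) `&`
    direction @^-1` A); last first.
  by apply/seteqP; split=> y /=; rewrite in_itv.
apply: measurableI; rewrite -[X in measurable X]setTI.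
  exact: measurable_enorm.
exact: measurable_direction.
Qed.

Let surface_measure0 : surface_measure set0 = 0.
Proof.
rewrite /surface_measure (_ : cone set0 = set0) ?measure0 ?mule0//.
by apply/seteqP; split=> y //= [].
Qed.

Let surface_measure_ge0 A : 0 <= surface_measure A.
Proof. by rewrite /surface_measure mule_ge0. Qed.

Let surface_measure_sigma_additive : semi_sigma_additive surface_measure.
Proof.
move=> F mF tF mUF; rewrite /surface_measure.
have -> : cone (\bigcup_k F k) = \bigcup_k cone (F k).
  apply/seteqP; split=> y.
    by move=> [y01 [k _ Fk]]; exists k.
  by move=> [k _ [y01 Fk]]; split => //; exists k.
under eq_fun do rewrite -ge0_sume_distrr//.
apply: cvgeZl => //; apply: measure_semi_sigma_additive.
- by move=> k; exact: measurable_cone.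
- apply/trivIsetP => /= i j _ _ ij; apply/seteqP; split=> y //= [].
  move=> [_ Fi] [_ Fj].
  move/trivIsetP : tF => /(_ _ _ Logic.I Logic.I ij) /seteqP[+ _].
  by apply; split; [exact: Fi|exact: Fj].
- by apply: bigcupT_measurable => k; exact: measurable_cone.
Qed.

HB.instance Definition _ := isMeasure.Build _ _ _ surface_measure
  surface_measure0 surface_measure_ge0 surface_measure_sigma_additive.

End surface_measure.

Section complex_valued.
Context d (T : measurableType d) (R : realType) (mu : {measure set T -> \bar R}).

Definition Cintegral (D : set T) (f : T -> R[i]) : R[i] :=
  Complex (\int[mu]_(x in D) complex.Re (f x))
          (\int[mu]_(x in D) complex.Im (f x)).

Definition CLnorm (p : R) (f : T -> R[i]) : \bar R :=
  Lnorm mu p%:E (fun x => (Normc.normc (f x))%:E).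

End complex_valued.

Section schwartz.
Context (R : realType) (n : nat).

Fixpoint partial (s : seq 'I_n) (g : 'rV[R]_n -> R) : 'rV[R]_n -> R :=
  if s is j :: s' then fun x => 'D_(delta_mx ord0 j) (partial s' g) x else g.

Definition real_schwartz (g : 'rV[R]_n -> R) : Prop :=
  forall s : seq 'I_n,
    (forall x, differentiable (partial s g) x) /\
    forall a : 'I_n -> nat, exists C : R, forall x : 'rV[R]_n,
      `|(\prod_j x ord0 j ^+ a j) * partial s g x| <= C.

Definition schwartz (f : 'rV[R]_n -> R[i]) : Prop :=
  real_schwartz (fun x => complex.Re (f x)) /\
  real_schwartz (fun x => complex.Im (f x)).

End schwartz.

Section singular_integral.
Context (R : realType) (m n : nat).

(* A function on the unit sphere is a function on the ambient space of which
   only the values on unit_sphere matter. *)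
Definition sphere_Lq (q : R) (Omega : 'M[R]_(m, n) -> R[i]) : Prop :=
  [/\ measurable_fun (@unit_sphere R m n) (fun y => complex.Re (Omega y)),
      measurable_fun (@unit_sphere R m n) (fun y => complex.Im (Omega y)) &
      (CLnorm (@surface_measure R m n) q Omega < +oo)%E].

Definition mean_zero (Omega : 'M[R]_(m, n) -> R[i]) : Prop :=
  Cintegral (@surface_measure R m n) (@unit_sphere R m n) Omega = 0.

Definition rough_kernel (Omega : 'M[R]_(m, n) -> R[i]) (y : 'M[R]_(m, n)) :
    R[i] :=
  Omega (direction y) / (enorm y ^+ (m * n))%:C%C.

Definition truncated_L (Omega : 'M[R]_(m, n) -> R[i])
    (f : 'I_m -> 'rV[R]_n -> R[i]) (eps : R) (x : 'rV[R]_n) : R[i] :=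
  Cintegral (@lebesgue_mx R m n) [set y | eps < enorm y]
    (fun y => rough_kernel Omega y * \prod_(j < m) f j (x - row j y)).

(* The principal value is taken on real and imaginary parts; both limits exist
   when Omega is integrable with mean zero and the f j are Schwartz functions. *)
Definition cal_L (Omega : 'M[R]_(m, n) -> R[i])
    (f : 'I_m -> 'rV[R]_n -> R[i]) (x : 'rV[R]_n) : R[i] :=
  Complex (lim (complex.Re (truncated_L Omega f eps x) @[eps --> 0^'+]))
          (lim (complex.Im (truncated_L Omega f eps x) @[eps --> 0^'+])).

End singular_integral.

Definition calO (R : realType) (m : nat) (J : {set 'I_m}) (s : R) :
    set ('I_m -> R) :=
  [set t | (forall j, 0 < t j < 1) /\ \sum_(j in J) (s - t j) < - (1 - s)].

(* Main.v *)
Require Import Defs.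
From HB Require Import structures.
From mathcomp Require Import all_boot all_order all_algebra.
From mathcomp Require Import all_classical all_reals all_analysis.
From mathcomp Require Import measurable_realfun complex ring lra zify.
Set Implicit Arguments.
Unset Strict Implicit.
Unset Printing Implicit Defensive.
Import Order.TTheory GRing.Theory Num.Theory.
Import numFieldNormedType.Exports.
Local Open Scope classical_set_scope.
Local Open Scope ring_scope.

(** Write [t j = 1 / p_ j], [k = #|J|] and fix [j0] in [J].  The multiplier
    [Omega] is homogeneous of degree zero and blows up on the partial diagonal
    [{y | y_j = y_j0 for all j in J}], which has codimension [n (k - 1)]: on
    the side where the first coordinate of [y_j0] is positive it is the power
    [dist ^ (- a)] of a normalized distance to that diagonal, and on the
    opposite side a constant [- c] which makes the mean value vanish.  Such a
    power is in [L^q] of the sphere as soon as [a q < n (k - 1)]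
    ([sphere_Lq_rough_fun], [mean_zero_rough_fun]).

    The operator is tested on bumps [f_j] living at scale [delta] for [j] in
    [J] and at scale [1] for the other indices.  Let [x] range over the cube
    [2, 3]^n.  On the set of measure about [delta ^ (n k)] where
    [prod_j f_j (x - y_j)] is not small, all [y_j] with [j] in [J] lie within
    [O(delta)] of [x], so that [y] is at distance about [delta] from the
    diagonal and the kernel is of size [delta ^ (- a)].  Hence
    [L_Omega (f_1, .., f_m) >= K delta ^ (n k - a)] on the whole cube
    ([Re_cal_L_ge]), whereas the product of the norms of the [f_j] is at most
    [delta ^ (n sum_(j in J) t j)] ([prod_CLnorm_test_fun_le]).  Letting
    [delta] tend to zero, boundedness fails if
    [n k - a < n sum_(j in J) t j].  An exponent [a] meeting both requirements
    exists exactly when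
    [1 + (k - 1) (1 - 1 / q) < sum_(j in J) t j]
    ([unbounded_rough_operator]); for [q = 1 / (1 - s)] this is the condition
    defining [calO J s], and for [J] the full index set and [t j = 1 / 2] it
    is [q < 2 (m - 1) / m].

    Two choices keep the analysis elementary.  The bumps are compactly
    supported, which forces [|y| >= 1] in the integrand, so that the truncated
    integrals do not depend on the truncation parameter and the principal value
    is an ordinary integral.  The bump [f_j0] and the other bumps of index in
    [J] have disjoint supports, which keeps the integrand at distance
    [delta] from the singularity: it is bounded and its integral is
    finite. *)

(** * Smooth functions on the real line *)

Section flat_functions.
Context {R : realType}.

Lemma horner_expRN_bounded (P : {poly R}) :
  exists C : R, forall u, 0 <= u -> `|P.[u]| * expR (- u) <= C.
Proof.
exists (\sum_(i < size P) `|P`_i| * i`!%:R) => u u0.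
have mono i : u ^+ i * expR (- u) <= i`!%:R.
  rewrite expRN ler_pdivrMr ?expR_gt0//; case: i => [|i].
    by rewrite expr0 fact0 mul1r -expR0 ler_expR.
  rewrite mulrC -ler_pdivrMr ?ltr0n ?fact_gt0//.
  by apply: le_trans (expR_ge1Dxn i u0); rewrite lerDr.
rewrite horner_coef.
apply: (@le_trans _ _ ((\sum_(i < size P) `|P`_i * u ^+ i|) * expR (- u))).
  by rewrite ler_wpM2r ?expR_ge0// ler_norm_sum.
rewrite mulr_suml; apply: ler_sum => i _.
by rewrite normrM (ger0_norm (exprn_ge0 i u0)) -mulrA ler_wpM2l.
Qed.

(** The polynomial factor makes the family [flat P] stable under
    differentiation; [flat 1] is the classical flat function
    [exp (- 1 / x)]. *)
Definition flat (P : {poly R}) (x : R) : R :=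
  if 0 < x then P.[x^-1] * expR (- x^-1) else 0.

(** Away from [0] this is a computation.  At [0] the difference quotient is at
    most [C h], because [u ^+ 2 * P.[u] * exp (- u)] is bounded for
    [u = 1 / h]. *)
Lemma is_derive_flat (P : {poly R}) (x : R) :
  is_derive x 1 (flat P) (flat ('X^2 * (P - P^`())) x).
Proof.
have [x0|x0|->] := ltgtP x 0.
- rewrite {2}/flat ltNge (ltW x0) /=.
  apply: (@near_eq_is_derive _ _ _ (cst 0)) => //; near=> z.
  by rewrite /flat ltNge ltW//; near: z; exact: lt_nbhsl.
- rewrite {2}/flat x0.
  apply: (@near_eq_is_derive _ _ _
      ((fun z => P.[z^-1]) \* (fun z => expR (- z^-1)))).
    near=> z; rewrite /flat (_ : 0 < z)//; near: z.
    exact: lt_nbhsr.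
  have xN0 : x != 0 by rewrite gt_eqF.
  have dV : is_derive x 1 (fun z : R => z^-1) (- x^-2).
    apply: is_derive_eq; first exact: (@is_deriveV _ id).
    by rewrite /GRing.scale/= mulr1.
  have d1 : is_derive x 1 (fun z => P.[z^-1]) (P^`().[x^-1] * (- x^-2)).
    exact: (@is_derive1_comp _ (horner P) _ x _ _ (is_derive_poly P _) dV).
  have dN : is_derive x 1 (fun z : R => - z^-1) (x^-2).
    by rewrite -[X in is_derive _ _ _ X]opprK; exact: is_deriveN dV.
  have d2 : is_derive x 1 (fun z => expR (- z^-1)) (expR (- x^-1) * x^-2).
    exact: (@is_derive1_comp _ expR (fun z => - z^-1) x _ _
      (is_derive_expR _) dN).
  apply: is_derive_eq.
  by rewrite !hornerE /GRing.scale/= exprVn; ring.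
have [C CP] := horner_expRN_bounded ('X^2 * P).
rewrite {2}/flat ltxx.
have lim0 : (fun h => h^-1 *: ((flat P \o shift 0) (h *: 1) - flat P 0)) @ 0^'
    --> (0 : R).
  apply/cvgrPdist_le => e e0; near=> h.
  have hC : `|h| * (`|C| + 1) <= e.
    rewrite -ler_pdivlMr ?ltr_wpDl//; near: h; apply: dnbhs0_le.
    by rewrite divr_gt0// ltr_wpDl.
  rewrite /= addr0 /GRing.scale/= mulr1 {2}/flat ltxx subr0 sub0r normrN.
  rewrite /flat; case: ifPn => h0; last by rewrite mulr0 normr0 ltW.
  apply: le_trans hC; rewrite (gtr0_norm h0).
  have := CP h^-1; rewrite invr_ge0 => /(_ (ltW h0)).
  rewrite hornerM hornerXn !normrM (ger0_norm (expR_ge0 _)).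
  rewrite !normfV (gtr0_norm h0) -[_ * _ * expR _]mulrA.
  set A := `|_| * expR _ => H.
  rewrite (_ : h^-1 * A = h * (h^-1 * h^-1 * A)); last by field; rewrite gt_eqF.
  rewrite ler_wpM2l ?(ltW h0)// (le_trans H)// (le_trans (ler_norm _))//.
  by rewrite lerDl.
apply: DeriveDef; last exact: cvg_lim.
by apply/cvg_ex; exists 0; exact: lim0.
Unshelve. all: by end_near. Qed.

End flat_functions.

Section smooth_functions.
Context {R : realType}.
Implicit Types f g : R -> R.

(** Differentiability of the iterated derivatives is recorded one derivative at
    a time, so that closure under products and affine substitutions follows by
    induction on the order. *)
Fixpoint smooth_upto (k : nat) f : Prop :=
  if k is k'.+1 then (forall x, derivable f x 1) /\ smooth_upto k' (derive1 f)
  else True.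

Definition smooth f : Prop := forall k, smooth_upto k f.

Lemma smooth_derivable f x : smooth f -> derivable f x 1.
Proof. by move=> /(_ 1%N) []. Qed.

Lemma smooth_derive1 f : smooth f -> smooth (derive1 f).
Proof. by move=> sf k; have [] := sf k.+1. Qed.

Lemma smooth_uptoS k f : smooth_upto k.+1 f -> smooth_upto k f.
Proof.
elim: k f => // k IH f [df sf]; split=> //.
by apply: IH.
Qed.

Lemma smooth_uptoD k f g :
  smooth_upto k f -> smooth_upto k g -> smooth_upto k (f \+ g).
Proof.
elim: k f g => // k IH f g [df sf] [dg sg]; split=> [x|].
  exact: derivableD (df x) (dg x).
rewrite (_ : derive1 _ = (derive1 f) \+ (derive1 g)); first exact: IH.
by apply/funext => x /=; rewrite !derive1E (deriveD (df x) (dg x)).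
Qed.

Lemma smooth_uptoM k f g :
  smooth_upto k f -> smooth_upto k g -> smooth_upto k (f \* g).
Proof.
elim: k f g => // k IH f g /[dup] sf1 [df sf] /[dup] sg1 [dg sg]; split=> [x|].
  exact: derivableM (df x) (dg x).
rewrite (_ : derive1 _ = (f \* (derive1 g)) \+ (g \* (derive1 f))).
  by apply: smooth_uptoD; apply: IH => //; exact: smooth_uptoS.
by apply/funext => x /=; rewrite !derive1E (deriveM (df x) (dg x)).
Qed.

Lemma smooth_upto_cst k (c : R) : smooth_upto k (cst c).
Proof.
elim: k c => // k IH c; split=> [x|]; first exact: derivable_cst.
rewrite (_ : derive1 _ = cst 0); first exact: IH.
by apply/funext => x; rewrite derive1_cst.
Qed.

Lemma smooth_upto_affine k f (a b : R) :
  smooth_upto k f -> smooth_upto k (fun x => f (a * x + b)).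
Proof.
elim: k f => // k IH f [df sf].
have d (x : R) : is_derive x 1 (fun x => f (a * x + b)) ((derive1 f) (a * x + b) * a).
  apply: (@is_derive1_comp _ f (fun x => a * x + b)).
    by rewrite derive1E; exact: derivableP.
  apply: is_derive_eq.
  by rewrite /GRing.scale/= mulr1 addr0.
split=> [x|]; first exact: ex_derive.
rewrite (_ : derive1 _ = (fun x => (derive1 f) (a * x + b)) \* cst a).
  by apply: smooth_uptoM; [exact: IH|exact: smooth_upto_cst].
by apply/funext => x; rewrite derive1E; exact: derive_val.
Qed.

Lemma smooth_flat (P : {poly R}) : smooth (flat P).
Proof.
move=> k; elim: k P => // k IH P; split=> [x|].
  by have := is_derive_flat P x => ?; exact: ex_derive.
rewrite (_ : derive1 _ = flat ('X^2 * (P - P^`()))); first exact: IH.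
apply/funext => x; rewrite derive1E.
by have := is_derive_flat P x => ?; exact: derive_val.
Qed.

End smooth_functions.

(** * Tensor products and Schwartz functions *)

Section tensor_products.
Context {R : realType} {n : nat}.
Implicit Types (f : R -> R) (phi : 'I_n -> R -> R).

Definition tensor phi (x : 'rV[R]_n) : R := \prod_l phi l (x ord0 l).

Definition supported (M : R) f := forall t, M < `|t| -> f t = 0.

Lemma supported_derive1 M f : supported M f -> supported M (derive1 f).
Proof.
move=> sf t Mt; rewrite derive1E -[RHS](derive_cst (0 : R) t 1).
apply: near_eq_derive; near=> z; apply: sf.
by near: z; apply: (cvgr_gt `|t|) => //; exact: norm_continuous.
Unshelve. all: by end_near. Qed.

Lemma supported_mono_bounded M f (a : nat) : smooth f -> supported M f ->
  exists C : R, forall t, `|t ^+ a * f t| <= C.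
Proof.
move=> sf suppf.
have cf : continuous (fun t : R => `|t ^+ a * f t|).
  move=> t; apply: cvg_norm; apply: cvgM; first exact: exprn_continuous.
  apply: differentiable_continuous; apply/derivable1_diffP.
  exact: smooth_derivable.
have MM : - `|M| <= `|M| by rewrite (@le_trans _ _ 0)// oppr_le0.
have [c _ cmax] := EVT_max MM (continuous_subspaceT cf).
exists `|c ^+ a * f c| => t.
have [tM|Mt] := leP `|t| `|M|; first by apply: cmax; rewrite in_itv/= -ler_norml.
rewrite (suppf t) ?mulr0 ?normr0//.
by rewrite (le_lt_trans _ Mt)// ler_norm.
Qed.

Lemma differentiable_tensor phi x :
  (forall l, smooth (phi l)) -> differentiable (tensor phi) x.
Proof.
move=> sphi; rewrite /tensor.
elim: (index_enum _) => [|i r IH].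
  by under eq_fun do rewrite big_nil; exact: differentiable_cst.
under eq_fun do rewrite big_cons.
apply: differentiableM => //.
apply: (@differentiable_comp _ _ _ _ (fun y : 'rV[R]_n => y ord0 i) (phi i)).
  exact: differentiable_coord.
by apply/derivable1_diffP; exact: smooth_derivable.
Qed.

Lemma tensor_shift phi (j : 'I_n) x h :
  tensor phi (h *: delta_mx ord0 j + x) =
  phi j (h + x ord0 j) * \prod_(l | l != j) phi l (x ord0 l).
Proof.
rewrite /tensor (bigD1 j)//= !mxE !eqxx mulr1; congr (_ * _).
by apply: eq_bigr => l lj; rewrite !mxE eqxx (negbTE lj) mulr0 add0r.
Qed.

Lemma derive_tensor phi (j : 'I_n) x : (forall l, smooth (phi l)) ->
  'D_(delta_mx ord0 j) (tensor phi) x =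
  tensor (fun l => if l == j then derive1 (phi l) else phi l) x.
Proof.
move=> sphi; rewrite [RHS]/tensor (bigD1 j)//= eqxx.
under eq_bigr => l lj do rewrite (negbTE lj).
rewrite /derive.
under eq_fun => h.
  rewrite [(tensor phi \o _) _]tensor_shift -[x in tensor phi x]add0r.
  rewrite -[X in X + x](scale0r (delta_mx ord0 j)) tensor_shift add0r -mulrBl.
  rewrite [h^-1 *: _]mulrA.
  over.
apply: cvg_lim => //; apply: cvgM; last exact: cvg_cst.
have := @smooth_derivable _ _ (x ord0 j) (sphi j).
by rewrite /derivable /derive1; under eq_fun do rewrite /= [_ *: 1]mulr1.
Qed.

(** Differentiating in a coordinate only affects the corresponding factor, so
    all iterated partial derivatives stay within tensor products. *)
Lemma partial_tensor M phi (s : seq 'I_n) :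
  (forall l, smooth (phi l) /\ supported M (phi l)) ->
  exists psi, (forall l, smooth (psi l) /\ supported M (psi l)) /\
    partial s (tensor phi) = tensor psi.
Proof.
move=> phiP; elim: s => [|j s [psi [psiP psiE]]]; first by exists phi.
exists (fun l => if l == j then derive1 (psi l) else psi l); split=> [l|].
  case: ifP => // _; have [? ?] := psiP l.
  by split; [exact: smooth_derive1|exact: supported_derive1].
apply/funext => x /=; rewrite psiE derive_tensor// => l.
by have [] := psiP l.
Qed.

Lemma real_schwartz_tensor M phi :
  (forall l, smooth (phi l) /\ supported M (phi l)) -> real_schwartz (tensor phi).
Proof.
move=> phiP s; have [psi [psiP ->]] := partial_tensor s phiP; split=> [x|a].
  by apply: differentiable_tensor => l; have [] := psiP l.
have /choice[C CP] l : exists C, forall t, `|t ^+ a l * psi l t| <= C.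
  have [sl Ml] := psiP l; exact: (supported_mono_bounded (a l) sl Ml).
exists (\prod_l C l) => x.
rewrite /tensor -big_split/= normr_prod; apply: ler_prod => l _.
by rewrite normr_ge0 CP.
Qed.

End tensor_products.

(** * A bump function supported in the unit interval *)

Section bump.
Context {R : realType}.

Definition bump1 (t : R) : R := flat 1 t * flat 1 (1 - t).

Lemma smooth_bump1 : smooth bump1.
Proof.
move=> k; apply: smooth_uptoM; first exact: smooth_flat.
rewrite (_ : (fun t => _) = (fun t => flat 1 (-1 * t + 1))).
  by apply: smooth_upto_affine; exact: smooth_flat.
by apply/funext => t; rewrite mulN1r addrC.
Qed.

Lemma flat1_ge0 (t : R) : 0 <= flat 1 t.
Proof. by rewrite /flat; case: ifP => // _; rewrite hornerE mul1r expR_ge0. Qed.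

Lemma flat1_le1 (t : R) : flat 1 t <= 1.
Proof.
rewrite /flat; case: ifP => [t0|_]; last exact: ler01.
by rewrite hornerE mul1r expR_le1 oppr_le0 invr_ge0 ltW.
Qed.

Lemma flat1_ge (t : R) : 4^-1 <= t -> expR (- 4) <= flat 1 t.
Proof.
move=> t4; have t0 : 0 < t by rewrite (lt_le_trans _ t4).
rewrite /flat t0 hornerE mul1r ler_expR lerN2.
by rewrite -(invrK 4) lef_pV2// posrE.
Qed.

Lemma bump1_ge0 t : 0 <= bump1 t.
Proof. by rewrite mulr_ge0 ?flat1_ge0. Qed.

Lemma bump1_le1 t : bump1 t <= 1.
Proof. by rewrite mulr_ile1 ?flat1_ge0 ?flat1_le1. Qed.

Lemma bump1_eq0 t : ~~ (0 <= t <= 1) -> bump1 t = 0.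
Proof.
rewrite negb_and -!ltNge => /orP[t0|t1]; rewrite /bump1.
  by rewrite {1}/flat ltNge (ltW t0) mul0r.
by rewrite {2}/flat subr_gt0 ltNge (ltW t1) mulr0.
Qed.

Lemma bump1_ge t : 4^-1 <= t <= 3 / 4 -> expR (- 8) <= bump1 t.
Proof.
move=> /andP[t1 t3].
rewrite (_ : - 8 = - 4 + - 4)%R; last by lra.
rewrite expRD; apply: ler_pM; rewrite ?expR_ge0//; first exact: flat1_ge.
by apply: flat1_ge; lra.
Qed.

Lemma smooth_bump1_affine (a b : R) : smooth (fun t => bump1 (a * t + b)).
Proof. by move=> k; apply: smooth_upto_affine; exact: smooth_bump1. Qed.

Lemma supported_bump1_affine (a b M : R) : 0 < a -> `|b| + 1 <= M * a ->
  supported M (fun t => bump1 (a * t + b)).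
Proof.
move=> a0 bM t Mt; apply: bump1_eq0; apply/negP => /andP[t0 t1].
have : `|a * t| <= `|b| + 1.
  have := ler_norm b; have := ler_norm (- b); rewrite normrN ler_norml.
  by move=> ? ?; apply/andP; split; lra.
rewrite normrM (gtr0_norm a0) leNgt mulrC => /negP; apply.
by rewrite (le_lt_trans bM)// ltr_pM2r.
Qed.

End bump.

(** * Integrals of nonnegative functions *)

Section integral_bounds.
Local Open Scope ereal_scope.
Context d (T : measurableType d) (R : realType) (mu : {measure set T -> \bar R}).

(** The integral of a nonnegative function is the supremum of the integrals of
    the simple functions below it, so it is monotone on arbitrary functions;
    this gives bounds on norms of [cal_L], as a function of [x], from pointwise
    bounds alone. *)
Lemma ge0_le_integralT (f g : T -> \bar R) :
  (forall x, 0 <= f x) -> (forall x, f x <= g x) ->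
  \int[mu]_x f x <= \int[mu]_x g x.
Proof.
move=> f0 fg; have g0 x : 0 <= g x by exact: le_trans (fg x).
rewrite !ge0_integralTE//; apply: ge_ereal_sup => _ [h /= hf <-].
by apply: ereal_sup_ubound; exists h => // x; exact: le_trans (hf x) (fg x).
Qed.

Lemma integral_cst_indic (c : R) (A : set T) : (0 <= c)%R -> measurable A ->
  \int[mu]_x (c * \1_A x)%:E = c%:E * mu A.
Proof.
move=> c0 mA; under eq_integral do rewrite EFinM.
rewrite ge0_integralZl//.
- by rewrite integral_indic// setIT.
- by apply/measurable_EFinP; exact: measurable_indic.
Qed.

Lemma le_mu_bigsetU (I : Type) (r : seq I) (F : I -> set T) :
  (forall i, measurable (F i)) ->
  mu (\big[setU/set0]_(i <- r) F i) <= \sum_(i <- r) mu (F i).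
Proof.
move=> mF; elim: r => [|i r IH]; first by rewrite !big_nil measure0.
rewrite !big_cons; apply: (@le_trans _ _ (mu (F i) +
    mu (\big[setU/set0]_(j <- r) F j))).
  by apply: measureU2 => //; exact: bigsetU_measurable.
by rewrite leeD2l.
Qed.

End integral_bounds.

(** * The measure of a tube around a partial diagonal *)

Section boxes.
Context {R : realType} {m n : nat}.
Local Notation mu := (@lebesgue_mx R m n).

Lemma measurable_box (A : 'I_m -> 'I_n -> set R) :
  (forall i j, measurable (A i j)) ->
  measurable [set y : 'M[R]_(m, n) | forall i j, A i j (y i j)].
Proof.
move=> mA; rewrite (_ : mkset _ = \bigcap_(i in setT) \bigcap_(j in setT)
    ((fun y : 'M[R]_(m, n) => y i j) @^-1` A i j)); last first.
  by apply/seteqP; split=> y /= H i; [move=> _ j _; exact: H|move=> j; exact: H].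
apply: fin_bigcap_measurable => // i _; apply: fin_bigcap_measurable => // j _.
by rewrite -[X in measurable X]setTI; exact: measurable_coord.
Qed.

Definition mxbox (a b : 'I_m -> 'I_n -> R) : set 'M[R]_(m, n) :=
  [set y | forall i j, a i j <= y i j <= b i j].

Lemma mxboxE (a b : 'I_m -> 'I_n -> R) :
  mxbox a b = [set y | forall i j, [set` `[a i j, b i j]] (y i j)].
Proof. by apply/seteqP; split=> y /= H i j; have := H i j; rewrite in_itv. Qed.

Lemma measurable_mxbox a b : measurable (mxbox a b).
Proof.
rewrite mxboxE.
by apply: (@measurable_box (fun i j => [set` `[a i j, b i j]])) => i j;
  exact: measurable_itv.
Qed.

Lemma lebesgue_mxbox (a b : 'I_m -> 'I_n -> R) :
  (forall i j, a i j <= b i j) ->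
  mu (mxbox a b) = (\prod_i \prod_j (b i j - a i j))%:E.
Proof.
move=> ab; rewrite mxboxE (@lebesgue_mx_box _ _ _ (fun i j => [set` `[a i j, b i j]]))//.
rewrite -prodEFin; apply: eq_bigr => i _; rewrite -prodEFin.
apply: eq_bigr => j _; rewrite lebesgue_measure_itv/= lte_fin.
have [//|ba] := ltP (a i j); rewrite (_ : b i j = a i j) ?subrr//.
by apply/eqP; rewrite eq_le ba ab.
Qed.

End boxes.

Section diagonal_tube.
Context {R : realType} {m n : nat} (J : {set 'I_m}) (j0 : 'I_m).
Hypothesis J0 : j0 \in J.
Local Notation mu := (@lebesgue_mx R m n).

(* The boxes of the covering are indexed by the cell [z] of side [1 / N] of the
   cube [-1, 1]^n which contains row [j0]; the rows of index in [J] are then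
   confined to that cell enlarged by [1 / N] on both sides. *)
Let lo (N : nat) (z : {ffun 'I_n -> 'I_(2 * N).+1}) (i : 'I_m) (l : 'I_n) : R :=
  if i \in J then -1 + ((z l)%:R - 1) / N%:R else -1.
Let hi (N : nat) (z : {ffun 'I_n -> 'I_(2 * N).+1}) (i : 'I_m) (l : 'I_n) : R :=
  if i \in J then -1 + ((z l)%:R + 2) / N%:R else 1.

Lemma diagonal_tube_sub_boxes (N : nat) : (0 < N)%N ->
  [set y : 'M[R]_(m, n) | (forall i l, `|y i l| <= 1) /\
     forall i l, i \in J -> `|y i l - y j0 l| <= N%:R^-1] `<=`
  \big[setU/set0]_(z : {ffun 'I_n -> 'I_(2 * N).+1}) mxbox (lo z) (hi z).
Proof.
move=> N0 y /= [y1 yJ]; rewrite -bigcup_seq/=.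
have NR0 : (0 : R) < N%:R by rewrite ltr0n.
pose t l := (y j0 l + 1) * N%:R.
have t0 l : 0 <= t l.
  by rewrite mulr_ge0 ?ler0n//; have := y1 j0 l; rewrite ler_norml => /andP[]; lra.
have tN l : (Num.truncn (t l) < (2 * N).+1)%N.
  rewrite ltnS -(ler_nat R); apply: le_trans (_ : t l <= _).
    by have /andP[] := truncn_itv (t0 l).
  rewrite natrM ler_pM2r//.
  by have := y1 j0 l; rewrite ler_norml => /andP[]; lra.
(* [w] is the integer part of [t l], which may be [2 * N] when [y j0 l = 1]:
   this is why cells have indices in ['I_(2 * N).+1]. *)
exists [ffun l => Ordinal (tN l)]; first by rewrite /= mem_index_enum.
move=> i l; rewrite /lo /hi; case: ifPn => [iJ|_]; last by rewrite -ler_norml.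
rewrite ffunE /=; have /andP[] := truncn_itv (t0 l).
rewrite -[(Num.truncn _).+1]addn1 natrD.
move: (Num.truncn _)%:R => w w1 w2.
have yE : y j0 l = -1 + t l / N%:R by rewrite /t mulfK ?gt_eqF//; lra.
have := yJ i l iJ; rewrite ler_norml yE => /andP[H1 H2].
have e1 : w / N%:R <= t l / N%:R by rewrite ler_pM2r ?invr_gt0.
have e2 : t l / N%:R <= (w + 1) / N%:R by rewrite ler_pM2r ?invr_gt0// ltW.
by apply/andP; split; lra.
Qed.

(** The tube is covered by at most [(3 N)^n] boxes, of measure at most
    [3 ^ (m n) N ^ (- n k)] each, where [k] is the cardinality of [J]. *)
Lemma lebesgue_diagonal_tube (N : nat) (A : set 'M[R]_(m, n)) : (0 < N)%N ->
  measurable A ->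
  A `<=` [set y | (forall i l, `|y i l| <= 1) /\
     forall i l, i \in J -> `|y i l - y j0 l| <= N%:R^-1] ->
  (mu A <= (3 ^+ (n + m * n) * N%:R^-1 ^+ (n * #|J|.-1))%:E)%E.
Proof.
move=> N0 mA AN.
have NR0 : (0 : R) < N%:R by rewrite ltr0n.
have NV0 : (0 : R) < N%:R^-1 by rewrite invr_gt0.
have mbox z : measurable (mxbox (lo (N := N) z) (hi z)) by exact: measurable_mxbox.
apply: (@le_trans _ _ (mu (\big[setU/set0]_z mxbox (lo (N := N) z) (hi z)))).
  apply: le_measure; rewrite ?inE//; first exact: bigsetU_measurable.
  exact: subset_trans AN (diagonal_tube_sub_boxes N0).
apply: le_trans (le_mu_bigsetU _ _ _) _ => //.
apply: (@le_trans _ _ (\sum_(z : {ffun 'I_n -> 'I_(2 * N).+1})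
    (3 ^+ (m * n) * N%:R^-1 ^+ (n * #|J|))%:E)%E).
  apply: lee_sum => z _; rewrite /= lebesgue_mxbox; last first.
    move=> i l; rewrite /lo /hi; case: ifP => _; last by lra.
    by rewrite lerD2l ler_pM2r//; lra.
  rewrite lee_fin.
  rewrite (_ : _ * _ = \prod_(i < m) \prod_(l < n)
      (3 * (if i \in J then N%:R^-1 else 1) : R)); last first.
    under eq_bigr do rewrite big_split/= !prodr_const card_ord.
    rewrite big_split/= prodr_const card_ord -exprM mulnC; congr (_ * _).
    rewrite prodrXl -big_mkcond/= prodr_const mulnC exprM//.
  apply: ler_prod => i _; apply/andP; split.
    apply: prodr_ge0 => l _; rewrite /lo /hi; case: ifP => _; last by lra.
    rewrite (_ : _ - _ = 3 / N%:R); last by lra.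
    by rewrite mulr_ge0// ltW.
  apply: ler_prod => l _; rewrite /lo /hi; case: ifP => _; last by apply/andP; split; lra.
  rewrite (_ : _ - _ = 3 / N%:R); last by lra.
  by rewrite lexx andbT mulr_ge0// ltW.
rewrite sumEFin lee_fin sumr_const card_ffun !card_ord -[X in X <= _]mulr_natl.
rewrite exprD -mulrA.
rewrite -[#|J|](@prednK #|J|) /=; last by apply/card_gt0P; exists j0.
rewrite mulnS exprD natrX.
rewrite [X in X <= _](_ : _ = ((2 * N).+1%:R / N%:R) ^+ n *
  (3 ^+ (m * n) * N%:R^-1 ^+ (n * #|J|.-1))); last first.
  by rewrite exprMn; ring.
apply: ler_wpM2r; first by rewrite mulr_ge0// exprn_ge0// ltW.
apply: lerXn2r; rewrite ?nnegrE ?divr_ge0 ?ler0n//.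
by rewrite ler_pdivrMr// -natrM ler_nat; lia.
Qed.

End diagonal_tube.

(** * The Euclidean norm and the surface measure *)

Section euclidean_norm.
Context {R : realType} {m n : nat}.
Implicit Types (y : 'M[R]_(m, n)).

Lemma ler_coord_enorm y i l : `|y i l| <= enorm y.
Proof.
rewrite -sqrtr_sqr /enorm ler_wsqrtr// (bigD1 i)//= (bigD1 l)//=.
rewrite -addrA lerDl addr_ge0//; first by apply: sumr_ge0 => k _; exact: sqr_ge0.
by apply: sumr_ge0 => k _; apply: sumr_ge0 => k' _; exact: sqr_ge0.
Qed.

Lemma enorm_le y (M : R) : 0 <= M -> (forall i l, `|y i l| <= M) ->
  enorm y <= (m * n)%:R * M.
Proof.
move=> M0 yM; rewrite -[leRHS]ger0_norm ?mulr_ge0//.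
rewrite -sqrtr_sqr /enorm ler_wsqrtr//.
apply: (@le_trans _ _ (\sum_(i < m) \sum_(l < n) M ^+ 2)).
  apply: ler_sum => i _; apply: ler_sum => l _.
  by rewrite -[y i l ^+ 2]real_normK ?num_real// lerXn2r// nnegrE.
rewrite !sumr_const !card_ord -mulrnA -[leLHS]mulr_natl exprMn [(n * m)%N]mulnC.
rewrite ler_wpM2r ?sqr_ge0// -natrX ler_nat.
by case: (m * n)%N => // k; rewrite expnS expn1 leq_pmulr.
Qed.

Lemma enormZ (r : R) y : 0 <= r -> enorm (r *: y) = r * enorm y.
Proof.
move=> r0; rewrite /enorm.
under eq_bigr do under eq_bigr do rewrite mxE exprMn.
under eq_bigr do rewrite -mulr_sumr.
by rewrite -mulr_sumr sqrtrM ?sqr_ge0// sqrtr_sqr ger0_norm.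
Qed.

Lemma enorm_direction y : 0 < enorm y -> enorm (direction y) = 1.
Proof. by move=> y0; rewrite /direction enormZ ?invr_ge0 ?ltW// mulVf ?gt_eqF. Qed.

Local Notation sigma := (@surface_measure R m n).

Lemma cone_sub_box (A : set 'M[R]_(m, n)) :
  cone A `<=` mxbox (fun _ _ => -1) (fun _ _ => 1).
Proof.
move=> y [/andP[_ y1] _] i l.
by rewrite -ler_norml (le_trans (ler_coord_enorm _ _ _)).
Qed.

Lemma surface_measure_lty (A : set 'M[R]_(m, n)) : measurable A ->
  (sigma A < +oo)%E.
Proof.
move=> mA; rewrite /= /surface_measure lte_mul_pinfty//.
apply: (@le_lt_trans _ _
    (lebesgue_mx (mxbox (fun (_ : 'I_m) (_ : 'I_n) => -1 : R) (fun _ _ => 1)))).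
  apply: le_measure; rewrite ?inE; first exact: measurable_cone.
    exact: measurable_mxbox.
  exact: cone_sub_box.
by rewrite lebesgue_mxbox ?ltry// => i j; lra.
Qed.

End euclidean_norm.

(** * Integrability of powers of the inverse distance to the diagonal *)

Section slope.
Context {R : realType} {m n : nat} (J : {set 'I_m}) (j0 : 'I_m) (l0 : 'I_n).
Implicit Types (y : 'M[R]_(m, n)).
Local Notation sigma := (@surface_measure R m n).

Definition diag_dist y : R := \sum_(j in J) \sum_l `|y j l - y j0 l|.

(** The inverse of the distance to the partial diagonal, made homogeneous of
    degree zero by means of the coordinate [y j0 l0] and cut off to the side
    where this coordinate is positive.  It takes the value [0] on the diagonal
    itself, as [0^-1 = 0]. *)
Definition slope y : R := Num.max (y j0 l0) 0 / diag_dist y.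

Lemma diag_dist_ge0 y : 0 <= diag_dist y.
Proof. by apply: sumr_ge0 => j _; apply: sumr_ge0 => l _. Qed.

Lemma slope_ge0 y : 0 <= slope y.
Proof. by rewrite divr_ge0 ?diag_dist_ge0// le_max lexx orbT. Qed.

Lemma slope_npos y : y j0 l0 <= 0 -> slope y = 0.
Proof. by move=> y0; rewrite /slope max_r// mul0r. Qed.

Lemma ler_coord_diag_dist y j l : j \in J -> `|y j l - y j0 l| <= diag_dist y.
Proof.
move=> jJ; rewrite /diag_dist (bigD1 j)//= (bigD1 l)//= -addrA lerDl.
rewrite addr_ge0//; first by apply: sumr_ge0.
by apply: sumr_ge0 => k _; apply: sumr_ge0.
Qed.

Lemma slopeZ (r : R) y : 0 < r -> slope (r *: y) = slope y.
Proof.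
move=> r0; rewrite /slope mxE.
rewrite (_ : diag_dist _ = r * diag_dist y); last first.
  rewrite mulr_sumr; apply: eq_bigr => j _; rewrite mulr_sumr.
  by apply: eq_bigr => l _; rewrite !mxE -mulrBr normrM (gtr0_norm r0).
rewrite -[in Num.max _ 0](mulr0 r) -maxr_pMr ?ltW//.
by rewrite -mulf_div divff ?gt_eqF// mul1r.
Qed.

Lemma measurable_slope : measurable_fun setT slope.
Proof.
rewrite (_ : slope = (fun y => Num.max (y j0 l0) 0 * diag_dist y `^ (-1))).
  apply: measurable_funM.
    by apply: measurable_maxr; [exact: measurable_coord|exact: measurable_cst].
  apply: (@measurableT_comp _ _ _ _ _ _ (fun a : R => a `^ (-1))).
    exact: measurable_powR.
  rewrite /diag_dist; under eq_fun do rewrite big_mkcond/=.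
  apply: measurable_sum => j; case: (j \in J); last exact: measurable_cst.
  apply: measurable_sum => l; apply: measurableT_comp.
    exact: normr_measurable.
  by apply: measurable_funB; exact: measurable_coord.
by apply/funext => y; rewrite powR_inv1// diag_dist_ge0.
Qed.

Lemma measurable_slope_ge (a : R) : measurable [set y | a <= slope y].
Proof.
rewrite (_ : mkset _ = slope @^-1` `[a, +oo[); last first.
  by apply/seteqP; split=> y /=; rewrite in_itv/= andbT.
by rewrite -[X in measurable X]setTI; apply: measurable_slope.
Qed.

Hypothesis J0 : j0 \in J.

(** The superlevel set is a cone, so its surface measure is [m * n] times the
    Lebesgue measure of its part in the unit ball, where [0 <= y j0 l0 <= 1]
    and thus [diag_dist y <= 1 / N]. *)
Lemma surface_slope_ge (N : nat) : (0 < N)%N ->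
  (sigma [set y | (N%:R <= slope y)%R] <=
   ((m * n)%:R * 3 ^+ (n + m * n) * N%:R^-1 ^+ (n * #|J|.-1))%:E)%E.
Proof.
move=> N0; have NR0 : (0 : R) < N%:R by rewrite ltr0n.
rewrite /= /surface_measure -mulrA EFinM lee_wpmul2l//.
apply: (lebesgue_diagonal_tube J0 N0).
  by apply: measurable_cone; exact: measurable_slope_ge.
move=> y [/andP[y0 y1] /=]; rewrite slopeZ ?invr_gt0// => Ny.
have y1' i l : `|y i l| <= 1 by rewrite (le_trans (ler_coord_enorm _ _ _)).
split=> // i l iJ; apply: (le_trans (ler_coord_diag_dist _ _ iJ)).
have d0 : 0 < diag_dist y.
  rewrite lt_neqAle diag_dist_ge0 andbT eq_sym; apply/negP => /eqP d0.
  by move: Ny; rewrite /slope d0 invr0 mulr0 leNgt NR0.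
move: Ny; rewrite /slope ler_pdivlMr// => Ny.
rewrite -[leRHS]mul1r ler_pdivlMr// mulrC (le_trans Ny)// ge_max ler01 andbT.
by rewrite (le_trans (ler_norm _)).
Qed.

(** If [2 ^ i <= slope y < 2 ^ i.+1], the [i]-th term of the series dominates
    already. *)
Lemma slope_powR_dyadic (b : R) y : 0 <= b ->
  ((slope y `^ b)%:E <= 1 + \sum_(0 <= i <oo)
     ((2 `^ b * (2 `^ b) ^+ i) * \1_[set z | (2 ^ i)%:R <= slope z] y)%:E)%E.
Proof.
move=> b0.
have F0 i : (0 <= ((2 `^ b * (2 `^ b) ^+ i) *
    \1_[set z | (2 ^ i)%:R <= slope z] y)%:E :> \bar R)%E.
  by rewrite lee_fin !mulr_ge0 ?exprn_ge0 ?powR_ge0.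
have [u1|u1] := leP 1 (slope y); last first.
  rewrite -[leLHS]adde0; apply: leeD; last exact: nneseries_ge0.
  rewrite lee_fin [leRHS](_ : _ = 1 `^ b); last by rewrite powR1.
  by apply: ge0_ler_powR; rewrite ?nnegrE ?slope_ge0// ltW.
pose t := Num.truncn (slope y).
have t0 : (0 < t)%N by rewrite truncn_gt0.
have /andP[t1 t2] := truncn_itv (slope_ge0 y).
have /andP[i1 i2] := trunc_log_bounds (isT : 1 < 2)%N t0.
set i := trunc_log 2 t in i1 i2.
rewrite -[leLHS]add0e; apply: leeD; first exact: lee01.
apply: le_trans (nneseries_lim_ge i.+1 (fun k _ _ => F0 k)).
rewrite big_nat_recr//= -[leLHS]add0e; apply: leeD; first exact: sume_ge0.
rewrite lee_fin indicE mem_set/=; last first.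
  by rewrite (le_trans _ t1)// ler_nat.
rewrite mulr1 -exprS -powR_mulrn ?powR_ge0// powRAC powR_mulrn//.
apply: ge0_ler_powR; rewrite ?nnegrE ?slope_ge0//.
by rewrite (le_trans (ltW t2))// -natrX ler_nat.
Qed.

(** Integrating the dyadic bound term by term gives a geometric series of ratio
    [2 ^ (b - n (k - 1))], where [k] is the cardinality of [J]. *)
Lemma integral_slope_powR_lty (b : R) : 0 <= b < (n * #|J|.-1)%:R ->
  (\int[sigma]_y (slope y `^ b)%:E < +oo)%E.
Proof.
move=> /andP[b0 bD]; set D := (n * #|J|.-1)%N in bD.
pose F i (y : 'M[R]_(m, n)) := ((2 `^ b * (2 `^ b) ^+ i) *
  \1_[set z | (2 ^ i)%:R <= slope z] y)%:E.
have F0 i y : (0 <= F i y)%E.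
  by rewrite lee_fin !mulr_ge0 ?exprn_ge0 ?powR_ge0.
have mF i : measurable_fun setT (F i).
  apply/measurable_EFinP; apply: measurable_funM => //.
  by apply: measurable_indic; exact: measurable_slope_ge.
apply: (@le_lt_trans _ _ (\int[sigma]_y (1 + \sum_(0 <= i <oo) F i y))%E).
  apply: ge0_le_integralT => y; first by rewrite lee_fin powR_ge0.
  exact: slope_powR_dyadic.
rewrite ge0_integralD//; last 2 first.
- by move=> y _; exact: nneseries_ge0.
- exact: ge0_emeasurable_sum.
rewrite integral_cst// mul1e lte_add_pinfty//; first exact: surface_measure_lty.
rewrite integral_nneseries//.
set C : R := (m * n)%:R * 3 ^+ (n + m * n).
have C0 : 0 <= C by rewrite mulr_ge0 ?exprn_ge0.
pose z : R := 2 `^ b * 2^-1 ^+ D.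
have z0 : 0 < z by rewrite mulr_gt0 ?powR_gt0 ?exprn_gt0 ?invr_gt0.
have z1 : z < 1.
  rewrite /z exprVn -powR_mulrn// ltr_pdivrMr ?powR_gt0// mul1r.
  by rewrite /powR pnatr_eq0/= ltr_expR ltr_pM2r// ln_gt0// ltr1n.
apply: (@le_lt_trans _ _ (\sum_(0 <= i <oo) (geometric (2 `^ b * C) z i)%:E)%E).
  apply: lee_nneseries => [i _ _|i _]; first exact: integral_ge0.
  rewrite integral_cst_indic ?mulr_ge0 ?exprn_ge0 ?powR_ge0//; last first.
    exact: measurable_slope_ge.
  have := surface_slope_ge (_ : 0 < 2 ^ i)%N; rewrite expn_gt0 => /(_ isT).
  move/(lee_wpmul2l (_ : (0 <= (2 `^ b * (2 `^ b) ^+ i)%:E)%E)); rewrite lee_fin.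
  rewrite mulr_ge0 ?exprn_ge0 ?powR_ge0// => /(_ isT) /le_trans; apply.
  rewrite -EFinM lee_fin le_eqVlt; apply/orP; left; apply/eqP.
  rewrite /= /z natrX exprMn -exprVn -!exprM [(i * D)%N]mulnC -/D /C; ring.
apply: (@le_lt_trans _ _ ((2 `^ b * C) / (1 - z))%:E); last exact: ltry.
apply: lime_le.
  apply: is_cvg_nneseries => i _ _; rewrite lee_fin.
  by apply: geometric_ge0; [rewrite mulr_ge0 ?powR_ge0|exact: ltW].
near=> N; rewrite sumEFin lee_fin; apply: geometric_le_lim => //.
  by rewrite mulr_ge0 ?powR_ge0.
by rewrite gtr0_norm.
Unshelve. all: by end_near. Qed.

End slope.

(** * The multiplier *)

Lemma normc_real {R : realType} (x : R) : Normc.normc x%:C%C = `|x|.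
Proof. by rewrite /= expr0n/= addr0 sqrtr_sqr. Qed.

Section sphere.
Context {R : realType} {m n : nat} (j0 : 'I_m) (l0 : 'I_n).
Local Notation sigma := (@surface_measure R m n).
Local Notation S := (@unit_sphere R m n).

Definition neg_side : set 'M[R]_(m, n) := [set y | y j0 l0 < 0].

Lemma measurable_unit_sphere : measurable S.
Proof.
rewrite (_ : S = @enorm R m n @^-1` [set 1])//.
by rewrite -[X in measurable X]setTI; apply: measurable_enorm.
Qed.

Lemma measurable_neg_side : measurable neg_side.
Proof.
rewrite (_ : neg_side = (fun y : 'M[R]_(m, n) => y j0 l0) @^-1` `]-oo, 0[).
  by rewrite -[X in measurable X]setTI; apply: measurable_coord.
by apply/seteqP; split=> y /=; rewrite in_itv.
Qed.

(** The half-ball over this part of the sphere contains a small box in the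
    negative orthant. *)
Lemma surface_neg_side_gt0 : (0 < sigma (neg_side `&` S))%E.
Proof.
have mn0 : (0 < m * n)%N.
  by rewrite muln_gt0 (leq_ltn_trans _ (ltn_ord j0))// (leq_ltn_trans _ (ltn_ord l0)).
pose k : R := (m * n)%:R.
have k0 : 0 < k by rewrite ltr0n.
have kV : (2 * k)^-1 < k^-1 by rewrite ltf_pV2 ?posrE ?mulr_gt0//; lra.
have kV0 : 0 < (2 * k)^-1 by rewrite invr_gt0 mulr_gt0.
rewrite /= /surface_measure mule_gt0 ?lte_fin ?ltr0n//.
apply: (@lt_le_trans _ _ (lebesgue_mx (mxbox (fun (_ : 'I_m) (_ : 'I_n) => - k^-1)
    (fun _ _ => - (2 * k)^-1)))).
  rewrite lebesgue_mxbox; last by move=> i l; rewrite lerN2 ltW.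
  by rewrite lte_fin; apply: prodr_gt0 => i _; apply: prodr_gt0 => l _; lra.
apply: le_measure; rewrite ?inE; first exact: measurable_mxbox.
  by apply: measurable_cone; apply: measurableI;
    [exact: measurable_neg_side|exact: measurable_unit_sphere].
move=> y ybox.
have y0 : y j0 l0 < 0.
  by have /andP[_ yb] := ybox j0 l0; rewrite (le_lt_trans yb)// oppr_lt0.
have ey0 : 0 < enorm y.
  by rewrite (lt_le_trans _ (ler_coord_enorm y j0 l0))// normr_gt0 lt_eqF.
split.
  rewrite ey0/= -[leRHS](@mulfV _ k) ?gt_eqF//; apply: enorm_le.
    by rewrite invr_ge0 ltW.
  move=> i l; have /andP[a1 a2] := ybox i l.
  rewrite ler_norml a1 (le_trans a2)// (@le_trans _ _ 0)// ?oppr_le0 ?invr_ge0 ltW//.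
  by rewrite mulr_gt0.
split; last exact: enorm_direction.
by rewrite /neg_side/= mxE pmulr_rlt0// invr_gt0.
Qed.

End sphere.

Section rough_function.
Context {R : realType} {m n : nat} (J : {set 'I_m}) (j0 : 'I_m) (l0 : 'I_n).
Hypothesis J0 : j0 \in J.
Local Notation sigma := (@surface_measure R m n).
Local Notation S := (@unit_sphere R m n).
Local Notation slope := (@slope R m n J j0 l0).
Local Notation neg_side := (@neg_side R m n j0 l0).

(** The two terms live on the disjoint sides [y j0 l0 > 0] and [y j0 l0 < 0];
    the second one only serves to adjust the mean value. *)
Definition rough_fun (a c : R) (y : 'M[R]_(m, n)) : R :=
  slope y `^ a - c * \1_neg_side y.

Lemma measurable_rough_fun a c : measurable_fun setT (rough_fun a c).
Proof.
apply: measurable_funB.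
  apply: (@measurableT_comp _ _ _ _ _ _ (fun u : R => u `^ a)).
    exact: measurable_powR.
  exact: measurable_slope.
apply: measurable_funM => //; apply: measurable_indic.
exact: measurable_neg_side.
Qed.

Lemma rough_fun_direction a c y : 0 < enorm y ->
  rough_fun a c (direction y) = rough_fun a c y.
Proof.
move=> y0; rewrite /rough_fun slopeZ ?invr_gt0//; congr (_ - _ * _).
rewrite !indicE (_ : (direction y \in neg_side) = (y \in neg_side))//.
by apply/idP/idP => /set_mem h; apply/mem_set; move: h;
  rewrite /neg_side/= mxE pmulr_rlt0 ?invr_gt0.
Qed.

Lemma rough_fun_pos a c (y : 'M[R]_(m, n)) :
  0 <= y j0 l0 -> rough_fun a c y = slope y `^ a.
Proof.
move=> y0; rewrite /rough_fun indicE memNset ?mulr0 ?subr0//=.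
by apply/negP; rewrite -leNgt.
Qed.

Lemma norm_rough_fun_powR_le a c q y : 0 < a -> 0 <= c -> 0 <= q ->
  `|rough_fun a c y| `^ q <= slope y `^ (a * q) + c `^ q.
Proof.
move=> a0 c0 q0; have [y0|y0] := leP 0 (y j0 l0).
  rewrite rough_fun_pos// ger0_norm ?powR_ge0// powRrM.
  by rewrite lerDl powR_ge0.
rewrite /rough_fun (slope_npos _ (ltW y0)) indicE mem_set// mulr1.
rewrite powR0 ?gt_eqF// sub0r normrN (ger0_norm c0).
by rewrite lerDr powR_ge0.
Qed.

Lemma sphere_Lq_rough_fun a c q : 0 < a -> 0 <= c -> 1 <= q ->
  a * q < (n * #|J|.-1)%:R ->
  sphere_Lq q (fun y => (rough_fun a c y)%:C%C).
Proof.
move=> a0 c0 q1 aq; have q0 : 0 < q by rewrite (lt_le_trans _ q1).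
split; [|exact: measurable_cst|].
  by apply: measurable_funTS; exact: measurable_rough_fun.
rewrite /CLnorm unlock; apply: poweR_lty.
apply: (@le_lt_trans _ _ (\int[sigma]_y
    ((slope y `^ (a * q))%:E + (c `^ q)%:E))%E).
  apply: ge0_le_integralT => y; first exact: poweR_ge0.
  rewrite normc_real /= normr_id -EFinD lee_fin.
  by apply: norm_rough_fun_powR_le => //; exact: ltW.
have ms : measurable_fun setT (fun y => (slope y `^ (a * q))%:E).
  apply/measurable_EFinP.
  apply: (@measurableT_comp _ _ _ _ _ _ (fun u : R => u `^ (a * q))).
    exact: measurable_powR.
  exact: measurable_slope.
have s0 y : setT y -> (0 <= (slope y `^ (a * q))%:E)%E.
  by move=> _; rewrite lee_fin powR_ge0.
have c0q y : [set: 'M[R]_(m, n)] y -> (0 <= (c `^ q)%:E)%E.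
  by move=> _; rewrite lee_fin powR_ge0.
rewrite (ge0_integralD _ _ s0 ms c0q)//.
rewrite lte_add_pinfty//.
  by apply: integral_slope_powR_lty => //; rewrite aq mulr_ge0// ltW.
rewrite integral_cst//; apply: lte_mul_pinfty => //.
  by rewrite lee_fin powR_ge0.
exact: surface_measure_lty.
Qed.

Lemma mean_zero_rough_fun a : 0 < a < (n * #|J|.-1)%:R ->
  exists2 c, 0 <= c & mean_zero (fun y => (rough_fun a c y)%:C%C).
Proof.
move=> /andP[a0 aD].
pose I1 := (\int[sigma]_(y in S) (slope y `^ a))%R.
pose I2 := fine (sigma (neg_side `&` S)).
have mS := @measurable_unit_sphere R m n.
have mN := @measurable_neg_side R m n j0 l0.
have I2_gt0 : 0 < I2.
  rewrite fine_gt0// surface_neg_side_gt0/=.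
  by apply: surface_measure_lty; exact: measurableI.
have int1 : sigma.-integrable S (EFin \o (fun y => slope y `^ a)).
  apply: (@integrableS _ _ _ _ setT) => //; apply/integrableP; split.
    apply/measurable_EFinP.
    apply: (@measurableT_comp _ _ _ _ _ _ (fun u : R => u `^ a)).
      exact: measurable_powR.
    exact: measurable_slope.
  under eq_integral do rewrite /= ger0_norm ?powR_ge0//.
  by apply: integral_slope_powR_lty => //; rewrite aD ltW.
have int2 : sigma.-integrable S (EFin \o (\1_neg_side : _ -> R)).
  apply: (@integrableS _ _ _ _ setT) => //; apply/integrableP; split.
    by apply/measurable_EFinP; exact: measurable_indic.
  under eq_integral do rewrite /= ger0_norm//.
  by rewrite integral_indic// setIT; exact: surface_measure_lty.
have I1_ge0 : 0 <= I1 by apply: Rintegral_ge0 => y _; exact: powR_ge0.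
exists (I1 / I2); first by rewrite divr_ge0// ltW.
rewrite /mean_zero /Cintegral /=.
have -> : (\int[sigma]_(y in S) rough_fun a (I1 / I2) y = 0)%R.
  rewrite /rough_fun RintegralB//; last first.
    under [X in _.-integrable _ X]eq_fun do rewrite /= EFinM.
    exact: integrableZl.
  rewrite RintegralZl// -/I1 [X in _ - _ * X](_ : _ = I2).
    by rewrite divfK ?subrr// gt_eqF.
  by rewrite /Rintegral integral_indic.
by rewrite Rintegral_cst// mul0r.
Qed.

End rough_function.

(** * The test functions *)

Section test_functions.
Context {R : realType} {m n : nat} (J : {set 'I_m}) (j0 : 'I_m).
Context (delta : R) (delta0 : 0 < delta) (delta4 : delta <= 4^-1).

Definition width (j : 'I_m) : R := if j \in J then delta else 1.

(** The shift by [2 * delta] separates [test_fun j0] from the other bumps of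
    index in [J], in every coordinate. *)
Definition corner (j : 'I_m) : R :=
  if (j \in J) && (j != j0) then 2 * delta else 0.

Definition test_fun (j : 'I_m) : 'rV[R]_n -> R :=
  tensor (fun (_ : 'I_n) t => bump1 ((width j)^-1 * t - corner j / width j)).

Lemma width_gt0 j : 0 < width j.
Proof. by rewrite /width; case: ifP. Qed.

Lemma corner_ge0 j : 0 <= corner j.
Proof. by rewrite /corner; case: ifP => // _; rewrite mulr_ge0// ltW. Qed.

Lemma corner_width_le1 j : corner j + width j <= 1.
Proof.
have := delta0; have := delta4.
by rewrite /corner /width; case: (j \in J); case: (j != j0) => /=; lra.
Qed.

Lemma real_schwartz_test_fun j : real_schwartz (test_fun j).
Proof.
have w0 := width_gt0 j.
apply: (@real_schwartz_tensor _ _ 1) => l; split; first exact: smooth_bump1_affine.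
apply: supported_bump1_affine; first by rewrite invr_gt0.
rewrite normrN ger0_norm ?divr_ge0 ?corner_ge0 ?(ltW w0)//.
rewrite -(ler_pM2r w0) mulrDl !mul1r divfK ?gt_eqF// mulVf ?gt_eqF//.
exact: corner_width_le1.
Qed.

Lemma real_schwartz0 : real_schwartz (fun _ : 'rV[R]_n => 0 : R).
Proof.
move=> s; have -> : partial s (fun _ : 'rV[R]_n => 0 : R) = cst 0.
  elim: s => //= j s ->; apply/funext => x; exact: derive_cst.
split=> [x|a]; first exact: differentiable_cst.
by exists 0 => x; rewrite mulr0 normr0.
Qed.

Lemma schwartz_test_fun j : schwartz (fun x => (test_fun j x)%:C%C).
Proof. by split; [exact: real_schwartz_test_fun|exact: real_schwartz0]. Qed.

Lemma test_fun_ge0 j x : 0 <= test_fun j x.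
Proof. by apply: prodr_ge0 => l _; exact: bump1_ge0. Qed.

Lemma test_fun_le1 j x : test_fun j x <= 1.
Proof.
apply: prodr_ile1 => l _.
by rewrite bump1_ge0 bump1_le1.
Qed.

Lemma test_fun_neq0 j x l : test_fun j x != 0 ->
  corner j <= x ord0 l <= corner j + width j.
Proof.
have w0 := width_gt0 j.
apply: contraNT => xl; apply/prodf_eq0; exists l => //; apply/eqP.
apply: bump1_eq0; apply: contra xl.
rewrite [_^-1 * _]mulrC -mulrBl ler_pdivlMr// ler_pdivrMr// mul0r mul1r.
by move=> /andP[? ?]; apply/andP; split; lra.
Qed.

Lemma test_fun_ge j (x : 'rV[R]_n) :
  (forall l, corner j + width j / 4 <= x ord0 l <= corner j + width j * 3 / 4) ->
  expR (- 8) ^+ n <= test_fun j x.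
Proof.
move=> xj; have w0 := width_gt0 j.
rewrite (_ : expR (- 8) ^+ n = \prod_(l < n) expR (- 8)); last first.
  by rewrite prodr_const card_ord.
apply: ler_prod => l _; rewrite expR_ge0/=; apply: bump1_ge.
have /andP[x1 x2] := xj l.
rewrite [_^-1 * _]mulrC -mulrBl ler_pdivlMr// ler_pdivrMr//.
by apply/andP; split; lra.
Qed.

Lemma CLnorm_test_fun_le (p : R) j : 0 < p ->
  (CLnorm (@lebesgue_mx R 1 n) p (fun x => (test_fun j x)%:C%C) <=
   (width j `^ (n%:R / p))%:E)%E.
Proof.
move=> p0; have w0 := width_gt0 j.
rewrite /CLnorm unlock.
apply: (@le_trans _ _ ((width j ^+ n)%:E `^ p^-1)%E); last first.
  by rewrite poweR_EFin -powR_mulrn ?(ltW w0)// -powRrM.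
pose B : set 'rV[R]_n :=
  mxbox (fun _ _ => corner j) (fun _ _ => corner j + width j).
apply: gt0_ler_poweR; first by rewrite invr_ge0 ltW.
- by rewrite in_itv/= leey andbT; apply: integral_ge0 => x _; rewrite lee_fin powR_ge0.
- by rewrite in_itv/= leey andbT lee_fin exprn_ge0 ?(ltW w0).
apply: (@le_trans _ _ (\int[@lebesgue_mx R 1 n]_x (1 * \1_B x)%:E)%E); last first.
  rewrite integral_cst_indic//; last exact: measurable_mxbox.
  rewrite /= lebesgue_mxbox; last by move=> i l; rewrite lerDl ltW.
  rewrite mul1e lee_fin big_ord1.
  under eq_bigr do rewrite addrC addKr.
  by rewrite prodr_const card_ord.
apply: ge0_le_integralT => x; first exact: poweR_ge0.
rewrite normc_real/= normr_id ger0_norm ?test_fun_ge0// mul1r lee_fin.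
have [->|fx0] := eqVneq (test_fun j x) 0; first by rewrite powR0 ?gt_eqF.
rewrite indicE mem_set/=; last by move=> i l; rewrite ord1; exact: test_fun_neq0.
rewrite [leRHS](_ : _ = 1 `^ p); last by rewrite powR1.
by apply: ge0_ler_powR; rewrite ?nnegrE ?test_fun_ge0 ?test_fun_le1// ltW.
Qed.

Lemma prod_CLnorm_test_fun_le (p_ : 'I_m -> R) : (forall j, 0 < p_ j) ->
  (\prod_(j < m) CLnorm (@lebesgue_mx R 1 n) (p_ j) (fun x => (test_fun j x)%:C%C) <=
   (delta `^ (n%:R * \sum_(j in J) (p_ j)^-1))%:E)%E.
Proof.
move=> p0; apply: (@le_trans _ _ (\prod_(j < m) (width j `^ (n%:R / p_ j))%:E)%E).
  suff : (0 <= \prod_(j < m)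
      CLnorm (@lebesgue_mx R 1 n) (p_ j) (fun x => (test_fun j x)%:C%C) <=
      \prod_(j < m) (width j `^ (n%:R / p_ j))%:E)%E by move=> /andP[].
  apply: (big_ind2 (fun a b : \bar R => 0 <= a <= b)%E) => [|a b a' b'|j _].
  - by rewrite lee01 lexx.
  - move=> /andP[a0 ab] /andP[a'0 ab'].
    by rewrite mule_ge0//= lee_pmul.
  - by rewrite CLnorm_test_fun_le// andbT; exact: Lnorm_ge0.
rewrite prodEFin lee_fin mulr_sumr.
rewrite (eq_bigr (fun j => if j \in J then delta `^ (n%:R / p_ j) else 1)); last first.
  by move=> j _; rewrite /width; case: ifP => // _; rewrite powR1.
rewrite -big_mkcond/= le_eqVlt; apply/orP; left; apply/eqP.
symmetry; apply: (big_morph (powR delta)); last by rewrite powRr0.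
by move=> x y; rewrite powRD// (gt_eqF delta0) implybT.
Qed.

End test_functions.

(** * Lower bound for the operator on the test functions *)

(** The factors come, in this order, from the kernel singularity, from
    [|y| <= 3 m n], from the lower bound of the bumps, and from the proportion
    of their supports on which this bound holds. *)
Definition gain {R : realType} (m n : nat) (a : R) : R :=
  (3 * (m * n)%:R) `^ (- a) * (3 * (m * n)%:R) ^- (m * n) *
  expR (- 8) ^+ (n * m) * 2^-1 ^+ (m * n).

Section lower_bound.
Context {R : realType} {m n : nat} (J : {set 'I_m}) (j0 j1 : 'I_m) (l0 : 'I_n).
Hypotheses (J0 : j0 \in J) (J1 : j1 \in J) (j10 : j1 != j0).
Context (delta : R) (delta0 : 0 < delta) (delta4 : delta <= 4^-1).
Context (a c : R) (a0 : 0 < a).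
Context (x : 'rV[R]_n) (x23 : forall l, 2 <= x ord0 l <= 3).

Local Notation mu := (@lebesgue_mx R m n).
Local Notation width := (@width R m J delta).
Local Notation corner := (@corner R m J j0 delta).
Local Notation test_fun := (@test_fun R m n J j0 delta).
Local Notation slope := (@slope R m n J j0 l0).
Local Notation Omega := (@rough_fun R m n J j0 l0 a c).

Let P (y : 'M[R]_(m, n)) : R := \prod_(j < m) test_fun j (x - row j y).
Let F (y : 'M[R]_(m, n)) : R := Omega y / enorm y ^+ (m * n) * P y.

Let P_ge0 y : 0 <= P y.
Proof. by apply: prodr_ge0 => j _; exact: test_fun_ge0. Qed.

Let P_le1 y : P y <= 1.
Proof. by apply: prodr_ile1 => j _; rewrite test_fun_ge0 test_fun_le1. Qed.

Let shifted_coord (y : 'M[R]_(m, n)) (j : 'I_m) (l : 'I_n) :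
  (x - row j y) ord0 l = x ord0 l - y j l.
Proof. by rewrite !mxE. Qed.

Let P_neq0 y : P y != 0 ->
  forall j l, corner j <= x ord0 l - y j l <= corner j + width j.
Proof.
move=> Py j l; rewrite -shifted_coord; apply: test_fun_neq0 => //.
by apply: contra Py => /eqP Py; apply/prodf_eq0; exists j => //; apply/eqP.
Qed.

Let supp_coord y : P y != 0 -> forall j l, 1 <= y j l <= 3.
Proof.
move=> Py j l; have /andP[y1 y2] := P_neq0 Py j l; have /andP[x2 x3] := x23 l.
have := corner_width_le1 J j0 delta0 delta4 j.
have := corner_ge0 J j0 delta0 j.
by move=> ? ?; apply/andP; split; lra.
Qed.

Let mn : R := (m * n)%:R.

Let mn_gt0 : 0 < mn.
Proof.
rewrite ltr0n muln_gt0 (leq_ltn_trans _ (ltn_ord j0))//.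
by rewrite (leq_ltn_trans _ (ltn_ord l0)).
Qed.

Let supp_enorm y : P y != 0 -> 1 <= enorm y <= 3 * mn.
Proof.
move=> Py; apply/andP; split.
  apply: le_trans (ler_coord_enorm y j0 l0).
  have /andP[y1 _] := supp_coord Py j0 l0.
  by rewrite (le_trans y1)// ler_norm.
rewrite mulrC; apply: enorm_le => // i l.
have /andP[y1 y2] := supp_coord Py i l.
by rewrite ger0_norm// (le_trans ler01).
Qed.

(* Rows [x - y_j0] and [x - y_j1] lie in cubes at distance [delta], which gives
   the lower bound; all rows [x - y_j] with [j] in [J] lie in [0, 3 delta]^n,
   which gives the upper one. *)
Let supp_diag_dist y : P y != 0 -> delta <= diag_dist J j0 y <= 3 * mn * delta.
Proof.
have d0 := delta0.
move=> Py; apply/andP; split.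
  apply: le_trans (ler_coord_diag_dist _ _ l0 J1).
  have := P_neq0 Py j0 l0; have := P_neq0 Py j1 l0.
  rewrite /corner /width J0 J1 j10 eqxx/= => /andP[? ?] /andP[? ?].
  by rewrite distrC (le_trans _ (ler_norm _))//; lra.
apply: (@le_trans _ _ (\sum_(j < m) \sum_(l < n) 3 * delta)); last first.
  by rewrite !sumr_const !card_ord -mulrnA -[leLHS]mulr_natl /mn mulnC; lra.
rewrite /diag_dist big_mkcond/=; apply: ler_sum => j _.
case: ifPn => [jJ|_]; last first.
  by apply: sumr_ge0 => l _; rewrite mulr_ge0// ltW.
apply: ler_sum => l _.
have := P_neq0 Py j0 l; have := P_neq0 Py j l.
rewrite /corner /width J0 jJ eqxx/= ler_norml.
by case: (j != j0) => /= /andP[? ?] /andP[? ?]; apply/andP; split; lra.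
Qed.

Let supp_slope y : P y != 0 -> (3 * mn * delta)^-1 <= slope y <= 3 / delta.
Proof.
move=> Py; have /andP[d1 d2] := supp_diag_dist Py.
have /andP[y1 y3] := supp_coord Py j0 l0.
have dd : 0 < diag_dist J j0 y by rewrite (lt_le_trans delta0).
rewrite /slope max_l; last by rewrite (le_trans ler01).
apply/andP; split.
  rewrite -[leLHS]mul1r ler_pM// ?invr_ge0 ?lef_pV2 ?posrE ?mulr_gt0//.
  by rewrite !mulr_ge0// ltW.
by rewrite ler_pM ?invr_ge0 ?lef_pV2 ?posrE// ?(ltW dd)// (le_trans ler01).
Qed.

Let F_ge y : P y != 0 ->
  (3 * mn * delta)^-1 `^ a * (3 * mn) ^- (m * n) * P y <= F y <=
  (3 / delta) `^ a.
Proof.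
move=> Py; have /andP[e1 e2] := supp_enorm Py.
have /andP[s1 s2] := supp_slope Py.
have e0 : 0 < enorm y by rewrite (lt_le_trans ltr01).
have /andP[y1 _] := supp_coord Py j0 l0.
rewrite /F rough_fun_pos; last by rewrite (le_trans ler01).
have i0 : 0 <= (3 * mn * delta)^-1 by rewrite invr_ge0 !mulr_ge0// ltW.
apply/andP; split.
  apply: ler_wpM2r; first exact: P_ge0.
  apply: ler_pM; [exact: powR_ge0|by rewrite invr_ge0 exprn_ge0// mulr_ge0// ltW| |].
    apply: ge0_ler_powR; rewrite ?nnegrE ?(ltW a0)//.
    exact: le_trans s1.
  rewrite lef_pV2 ?posrE ?exprn_gt0 ?mulr_gt0//.
  by apply: lerXn2r; rewrite ?nnegrE ?mulr_ge0// ltW.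
rewrite -[leRHS]mulr1; apply: ler_pM => //.
  by rewrite mulr_ge0 ?powR_ge0 ?invr_ge0 ?exprn_ge0 ?(ltW e0).
rewrite -[leRHS]mulr1; apply: ler_pM; rewrite ?powR_ge0 ?invr_ge0 ?exprn_ge0 ?(ltW e0)//.
  apply: ge0_ler_powR; rewrite ?nnegrE ?(ltW a0)//; first exact: le_trans s1.
  by rewrite divr_ge0// ltW.
by rewrite invf_le1 ?exprn_gt0// exprn_ege1.
Qed.

Let F_eq0 y : P y = 0 -> F y = 0.
Proof. by move=> Py; rewrite /F Py mulr0. Qed.

Let F_ge0 y : 0 <= F y.
Proof.
have [Py|Py] := eqVneq (P y) 0; first by rewrite F_eq0.
have /andP[+ _] := F_ge Py; apply: le_trans.
by rewrite !mulr_ge0 ?powR_ge0 ?invr_ge0 ?exprn_ge0 ?mulr_ge0// ltW.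
Qed.

Let lower : R := (3 * mn * delta)^-1 `^ a * (3 * mn) ^- (m * n) *
  expR (- 8) ^+ (n * m) * \prod_(j < m) \prod_(l < n) (width j / 2).

Let F_integral_ge : (lower%:E <= \int[mu]_y (F y)%:E)%E.
Proof.
pose Q : set 'M[R]_(m, n) :=
  mxbox (fun j l => x ord0 l - corner j - width j * 3 / 4)
        (fun j l => x ord0 l - corner j - width j / 4).
set k := (3 * mn * delta)^-1 `^ a * (3 * mn) ^- (m * n) * expR (- 8) ^+ (n * m).
have k0 : 0 <= k.
  by rewrite !mulr_ge0 ?powR_ge0 ?invr_ge0 ?exprn_ge0 ?mulr_ge0 ?expR_ge0// ltW.
have -> : lower%:E = (\int[mu]_y (k * \1_Q y)%:E)%E.
  rewrite integral_cst_indic//; last exact: measurable_mxbox.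
  rewrite /= lebesgue_mxbox; last first.
    by move=> j l; have := width_gt0 J delta0 j; lra.
  rewrite -EFinM; congr (_ * _)%:E.
  by apply: eq_bigr => j _; apply: eq_bigr => l _; lra.
apply: ge0_le_integralT => y; first by rewrite lee_fin mulr_ge0.
rewrite lee_fin indicE; have [yQ|_] := boolP (y \in Q); last by rewrite mulr0.
move: yQ => /set_mem yQ; rewrite mulr1.
have Pk : expR (- 8) ^+ (n * m) <= P y.
  rewrite exprM (_ : _ ^+ m = \prod_(j < m) expR (- 8) ^+ n); last first.
    by rewrite prodr_const card_ord.
  apply: ler_prod => j _; rewrite exprn_ge0 ?expR_ge0//=.
  apply: test_fun_ge => // l; rewrite shifted_coord.
  have /andP[? ?] := yQ j l.
  by apply/andP; split; lra.
have Py : P y != 0.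
  by rewrite gt_eqF// (lt_le_trans _ Pk)// exprn_gt0// expR_gt0.
have /andP[+ _] := F_ge Py; apply: le_trans; apply: ler_wpM2l => //.
by rewrite mulr_ge0 ?powR_ge0 ?invr_ge0 ?exprn_ge0 ?mulr_ge0// ltW.
Qed.

Let F_integral_lty : (\int[mu]_y (F y)%:E < +oo)%E.
Proof.
pose B : set 'M[R]_(m, n) := mxbox (fun _ _ => 1) (fun _ _ => 3).
apply: (@le_lt_trans _ _ (\int[mu]_y ((3 / delta) `^ a * \1_B y)%:E)%E).
  apply: ge0_le_integralT => y; first by rewrite lee_fin.
  rewrite lee_fin; have [Py|Py] := eqVneq (P y) 0.
    by rewrite F_eq0// mulr_ge0 ?powR_ge0.
  have /andP[_ Fy] := F_ge Py.
  by rewrite indicE mem_set ?mulr1//=; exact: supp_coord.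
rewrite integral_cst_indic ?powR_ge0//; last exact: measurable_mxbox.
by rewrite /= lebesgue_mxbox ?ltry// => j l; lra.
Qed.

Let truncated_integrand (y : 'M[R]_(m, n)) : 0 < enorm y ->
  complex.Re (rough_kernel (fun y => (Omega y)%:C%C) y *
    \prod_(j < m) (test_fun j (x - row j y))%:C%C) = F y.
Proof.
move=> y0; rewrite /rough_kernel rough_fun_direction//.
by rewrite -rmorph_prod -fmorphV -!rmorphM.
Qed.

(* The integrand vanishes for [enorm y < 1], hence the independence of [eps]. *)
Let Re_truncated_L (eps : R) : 0 < eps < 1 ->
  complex.Re (truncated_L (fun y => (Omega y)%:C%C)
    (fun j z => (test_fun j z)%:C%C) eps x) = \int[mu]_y F y.
Proof.
move=> /andP[eps0 eps1]; rewrite /truncated_L /Cintegral.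
rewrite [LHS](_ : _ = \int[mu]_(y in [set y | eps < enorm y])
    complex.Re (rough_kernel (fun y => (Omega y)%:C%C) y *
      \prod_(j < m) (test_fun j (x - row j y))%:C%C))//.
rewrite (@eq_Rintegral _ _ _ _ _ F); last first.
  by move=> y /set_mem /= y0; apply: truncated_integrand; exact: lt_trans y0.
rewrite Rintegral_mkcond; apply: eq_Rintegral => y _.
rewrite patchE; case: ifPn => // /negP yeps.
have [/F_eq0 ->//|/supp_enorm /andP[e1 _]] := eqVneq (P y) 0.
by exfalso; apply: yeps; rewrite inE/= (lt_le_trans eps1).
Qed.

Let lowerE : lower = gain m n a * delta `^ ((n * #|J|)%:R - a).
Proof.
rewrite /lower.
have -> : (3 * mn * delta)^-1 `^ a = (3 * mn) `^ (- a) * delta `^ (- a).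
  rewrite -powR_inv1 ?mulr_ge0 ?(ltW delta0) ?(ltW mn_gt0)// -powRrM mulN1r.
  by rewrite powRM ?mulr_ge0 ?(ltW delta0) ?(ltW mn_gt0).
have -> : \prod_(j < m) \prod_(l < n) (width j / 2) =
    2^-1 ^+ (m * n) * delta ^+ (n * #|J|).
  under eq_bigr do rewrite prodr_const card_ord.
  rewrite prodrXl big_split/= prodr_const card_ord exprMn -exprM mulrC.
  by congr (_ * _); rewrite -big_mkcond/= prodr_const -exprM mulnC.
rewrite powRD ?(gt_eqF delta0) ?implybT// powR_mulrn ?(ltW delta0)//.
by rewrite /gain -/mn; ring.
Qed.

(** The exponent combines the measure [delta ^ (n k)] of the set where the bumps
    are bounded below and the size [delta ^ (- a)] of the kernel there. *)
Lemma Re_cal_L_ge :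
  gain m n a * delta `^ ((n * #|J|)%:R - a) <=
  complex.Re (cal_L (fun y => (Omega y)%:C%C)
    (fun j z => (test_fun j z)%:C%C) x).
Proof.
rewrite -lowerE.
rewrite /cal_L [X in _ <= X](_ : _ = \int[mu]_y F y).
  rewrite /Rintegral -lee_fin fineK; first exact: F_integral_ge.
  rewrite ge0_fin_numE ?F_integral_lty//.
  by apply: integral_ge0 => y _; rewrite lee_fin.
apply: cvg_lim => //; apply: cvg_near_cst; near=> eps.
by apply: Re_truncated_L; apply/andP; split.
Unshelve. all: by end_near. Qed.

End lower_bound.

(** * Unboundedness *)

Lemma CLnorm_ge {R : realType} {n : nat} (p L : R) (g : 'rV[R]_n -> R[i]) :
  0 < p -> 0 <= L ->
  (forall x : 'rV[R]_n, (forall l, 2 <= x ord0 l <= 3) -> L <= complex.Re (g x)) ->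
  (L%:E <= CLnorm (@lebesgue_mx R 1 n) p g)%E.
Proof.
move=> p0 L0 gL; rewrite /CLnorm unlock.
have -> : L%:E = ((L `^ p)%:E `^ p^-1)%E.
  by rewrite poweR_EFin -powRrM mulfV ?gt_eqF// powRr1.
apply: gt0_ler_poweR; first by rewrite invr_ge0 ltW.
- by rewrite in_itv/= leey andbT lee_fin powR_ge0.
- by rewrite in_itv/= leey andbT; apply: integral_ge0 => x _; rewrite lee_fin powR_ge0.
pose B : set 'rV[R]_n := mxbox (fun _ _ => 2) (fun _ _ => 3).
apply: (@le_trans _ _ (\int[@lebesgue_mx R 1 n]_x (L `^ p * \1_B x)%:E)%E).
  rewrite integral_cst_indic ?powR_ge0//; last exact: measurable_mxbox.
  rewrite /= lebesgue_mxbox; last by move=> i l; lra.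
  rewrite big1 ?mule1// => i _; rewrite big1// => l _; lra.
apply: ge0_le_integralT => x; first by rewrite lee_fin mulr_ge0 ?powR_ge0.
rewrite lee_fin indicE; have [xB|_] := boolP (x \in B); last first.
  by rewrite mulr0 powR_ge0.
rewrite mulr1; apply: ge0_ler_powR; rewrite ?nnegrE ?(ltW p0)//.
move: xB => /set_mem xB; apply: le_trans (gL x (fun l => xB ord0 l)) _.
apply: le_trans (ler_norm _); case: (g x) => u v /=.
by rewrite (le_trans (ler_norm u))// -sqrtr_sqr ler_wsqrtr// lerDl sqr_ge0.
Qed.

Lemma gain_gt0 {R : realType} (m n : nat) (a : R) : (0 < m * n)%N ->
  0 < gain m n a.
Proof.
move=> mn0; have mnR : 0 < 3 * (m * n)%:R :> R by rewrite mulr_gt0 ?ltr0n.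
by rewrite !mulr_gt0 ?powR_gt0 ?invr_gt0 ?exprn_gt0 ?expR_gt0 ?invr_gt0.
Qed.

Lemma small_power {R : realType} (eta K C : R) : 0 < eta -> 0 < K -> 0 <= C ->
  exists2 delta, 0 < delta <= 4^-1 & C * delta `^ eta < K.
Proof.
move=> eta0 K0 C0; pose r := (K / (C + 1)) `^ eta^-1.
have C1 : 0 < C + 1 by rewrite ltr_wpDl.
have r0 : 0 < r by rewrite powR_gt0// divr_gt0.
exists (Num.min 4^-1 r); first by rewrite lt_min r0 invr_gt0 ltr0n/= ge_min lexx.
have dr : Num.min 4^-1 r `^ eta <= K / (C + 1).
  rewrite [leRHS](_ : _ = r `^ eta); last first.
    by rewrite /r -powRrM mulVf ?gt_eqF// powRr1// divr_ge0// ltW.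
  apply: ge0_ler_powR; first exact: ltW.
  - by rewrite nnegrE le_min (ltW r0) invr_ge0 ler0n.
  - by rewrite nnegrE ltW.
  - by rewrite ge_min lexx orbT.
apply: (@le_lt_trans _ _ (C * (K / (C + 1)))); first by rewrite ler_wpM2l.
by rewrite mulrA ltr_pdivrMr// mulrDr mulr1 mulrC ltrDl.
Qed.

(** Comparing the two powers of [delta] leaves
    [K <= |C| delta ^ (a - n (k - t))] for all small [delta], which is absurd as
    the exponent is positive. *)
Lemma unbounded_rough_operator (R : realType) (m n : nat) (J : {set 'I_m})
    (p q : R) (p_ : 'I_m -> R) :
  (0 < n)%N -> (2 <= #|J|)%N -> 1 <= q -> 0 < p -> (forall j, 1 < p_ j) ->
  1 + (#|J|%:R - 1) * (1 - q^-1) < \sum_(j in J) (p_ j)^-1 ->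
  exists Omega : 'M[R]_(m, n) -> R[i],
    [/\ sphere_Lq q Omega, mean_zero Omega &
      ~ exists C : R, forall f : 'I_m -> 'rV[R]_n -> R[i],
          (forall j, schwartz (f j)) ->
          (CLnorm (@lebesgue_mx R 1 n) p (cal_L Omega f) <=
           C%:E * \prod_(j < m) CLnorm (@lebesgue_mx R 1 n) (p_ j) (f j))%E].
Proof.
move=> n0 J2 q1 p0 p1 sumJ.
have /card_gt1P[j0 [j1 [J0 J1 j01]]] := J2.
have q0 : 0 < q by rewrite (lt_le_trans ltr01).
have pj0 j : 0 < p_ j by rewrite (lt_trans ltr01).
pose l0 : 'I_n := Ordinal n0.
pose k : R := #|J|%:R; pose t := \sum_(j in J) (p_ j)^-1.
have k1E : (n * #|J|.-1)%:R = n%:R * (k - 1) :> R.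
  by rewrite natrM /k -(@prednK #|J|) ?(ltnW J2)// -natr1 addrK.
have tk : t <= k.
  rewrite /k -sumr_const; apply: ler_sum => j _.
  by rewrite invf_le1// ltW.
have nR0 : 0 < n%:R :> R by rewrite ltr0n.
(* The midpoint of the open interval allowed for [a]: its left end comes from
   unboundedness, its right end from integrability of the [q]-th power. *)
pose a := n%:R * ((k - t) + (k - 1) / q) / 2.
have key : k - t < (k - 1) / q.
  by move: sumJ; rewrite -/k -/t mulrBr mulr1; lra.
have a_gt : n%:R * (k - t) < a by rewrite /a -mulrA ltr_pM2l//; lra.
have a_lt : a < n%:R * ((k - 1) / q) by rewrite /a -mulrA ltr_pM2l//; lra.
have a0 : 0 < a by apply: le_lt_trans a_gt; rewrite mulr_ge0 ?(ltW nR0)// subr_ge0.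
have aq : a * q < (n * #|J|.-1)%:R by rewrite k1E -ltr_pdivlMr// -mulrA.
have a1 : a < (n * #|J|.-1)%:R.
  by apply: le_lt_trans aq; rewrite -[leLHS]mulr1 ler_wpM2l// ltW.
have [c c0 meanO] : exists2 c, 0 <= c &
    mean_zero (fun y => (rough_fun J j0 l0 a c y)%:C%C).
  by apply: mean_zero_rough_fun => //; rewrite a0.
exists (fun y => (rough_fun J j0 l0 a c y)%:C%C); split => //.
  exact: sphere_Lq_rough_fun.
move=> [C HC].
have mn0 : (0 < m * n)%N by rewrite muln_gt0 n0 (leq_ltn_trans _ (ltn_ord j0)).
have eta0 : 0 < a - n%:R * (k - t) by rewrite subr_gt0.
have [delta /andP[d0 d4] dC] :=
  small_power eta0 (gain_gt0 a mn0) (normr_ge0 C).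
pose f j (x : 'rV[R]_n) := (test_fun J j0 delta j x)%:C%C.
pose L := gain m n a * delta `^ ((n * #|J|)%:R - a).
have L0 : 0 <= L by rewrite mulr_ge0 ?powR_ge0// ltW// gain_gt0.
have lowL : (L%:E <= CLnorm (@lebesgue_mx R 1 n) p
    (cal_L (fun y => (rough_fun J j0 l0 a c y)%:C%C) f))%E.
  apply: CLnorm_ge => // x x23.
  by apply: (@Re_cal_L_ge _ _ _ J j0 j1) => //; rewrite eq_sym.
have := le_trans lowL (HC f (schwartz_test_fun J j0 d0 d4)).
rewrite leNgt => /negP; apply.
apply: (@le_lt_trans _ _ (`|C|%:E * (delta `^ (n%:R * t))%:E)%E).
  apply: (@le_trans _ _ (`|C|%:E * \prod_(j < m)
      CLnorm (@lebesgue_mx R 1 n) (p_ j) (f j))%E).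
    apply: lee_wpmul2r; last by rewrite lee_fin ler_norm.
    by apply: prode_ge0 => j _; exact: Lnorm_ge0.
  by apply: lee_wpmul2l => //; exact: prod_CLnorm_test_fun_le.
rewrite -EFinM lte_fin /L.
have -> : n%:R * t = (a - n%:R * (k - t)) + ((n * #|J|)%:R - a).
  by rewrite natrM -/k; ring.
by rewrite powRD ?(gt_eqF d0) ?implybT// mulrA ltr_pM2r// powR_gt0.
Qed.

Theorem theorem1p2 (R : realType) (m n : nat) (hm : (2 <= m)%N)
    (hn : (1 <= n)%N) :
  (forall (s p : R) (p_ : 'I_m -> R),
    0 < s < 1 ->
    (forall j, 1 < p_ j) ->
    m%:R^-1 < p ->
    p^-1 = \sum_(j < m) (p_ j)^-1 ->
    (\bigcup_(J in [set J : {set 'I_m} | (2 <= #|J|)%N]) calO J s)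
      (fun j => (p_ j)^-1) ->
    exists Omega : 'M[R]_(m, n) -> R[i],
      [/\ sphere_Lq (1 - s)^-1 Omega, mean_zero Omega &
        ~ exists C : R, forall f : 'I_m -> 'rV[R]_n -> R[i],
            (forall j, schwartz (f j)) ->
            (CLnorm (@lebesgue_mx R 1 n) p (cal_L Omega f) <=
             C%:E * CLnorm (@surface_measure R m n) (1 - s)^-1 Omega *
             \prod_(j < m) CLnorm (@lebesgue_mx R 1 n) (p_ j) (f j))%E]) /\
  (forall q : R,
    1 <= q < 2 * (m%:R - 1) / m%:R ->
    exists Omega : 'M[R]_(m, n) -> R[i],
      [/\ sphere_Lq q Omega, mean_zero Omega &
        ~ exists C : R, forall f : 'I_m -> 'rV[R]_n -> R[i],
            (forall j, schwartz (f j)) ->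
            (CLnorm (@lebesgue_mx R 1 n) (2 / m%:R) (cal_L Omega f) <=
             C%:E * \prod_(j < m) CLnorm (@lebesgue_mx R 1 n) 2 (f j))%E]).
Proof.
have m0 : 0 < m%:R :> R by rewrite ltr0n ltnW.
split=> [s p p_ /andP[s0 s1] p1 mp _ [J /= J2 [_ sumJ]]|q /andP[q1 qm]].
- have s1' : 0 < 1 - s by rewrite subr_gt0.
  have q1 : 1 <= (1 - s)^-1 by rewrite invf_ge1//; lra.
  have p0 : 0 < p by rewrite (lt_trans _ mp)// invr_gt0.
  have [|Omega [OmegaLq Omega0 unbd]] :=
      unbounded_rough_operator hn J2 q1 p0 p1.
    move: sumJ; rewrite big_split/= sumr_const sumrN invrK -[s *+ _]mulr_natl.
    by set k := #|J|%:R; set t := \sum_(j in J) _; nra.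
  exists Omega; split => // -[C HC]; apply: unbd.
  have [_ _ Omegaoo] := OmegaLq.
  exists (C * fine (CLnorm (@surface_measure R m n) (1 - s)^-1 Omega)) => f Sf.
  rewrite EFinM fineK; first exact: HC.
  by rewrite ge0_fin_numE//; exact: Lnorm_ge0.
- have q0 : 0 < q by rewrite (lt_le_trans ltr01).
  apply: (@unbounded_rough_operator R m n [set: 'I_m]) => //.
  + by rewrite cardsT card_ord.
  + by rewrite divr_gt0.
  + by move=> _; lra.
  rewrite cardsT card_ord sumr_const cardsT card_ord -mulr_natl.
  have : m%:R / 2 < (m%:R - 1) / q.
    rewrite ltr_pdivlMr// mulrAC ltr_pdivrMr//.
    by move: qm; rewrite ltr_pdivlMr//; lra.
  by rewrite mulrBr mulr1; lra.
Qed.
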